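(* In MTT over the walking adjunction $\mathcal{M}_{adj}$, for every context $\Gamma$ at mode $n$, the type $\langle\nu\mid\mathsf{Bool}\rangle$ (with $\mathsf{Bool}$ formed in $\Gamma.\{\nu\}$ at mode $m$) is equivalent to $\mathsf{Bool}$ at mode $n$: $\langle\nu\mid\mathsf{Bool}\rangle\simeq\mathsf{Bool}$.
   Context: The walking adjunction $\mathcal{M}_{adj}$ is the 2-category freely generated by modes $m,n$, 1-cells $\nu: m\to n$, $\mu : n\to m$ and 2-cells $\eta : 1_m\Rightarrow\mu\circ\nu$, $\epsilon:\nu\circ\mu\Rightarrow 1_n$ satisfying the triangle identities. MTT over a mode theory is a dependent type theory with, at each mode, $\Pi$, $\Sigma$, intensional identity types, a type $\mathsf{Bool}$ with $\mathsf{true},\mathsf{false}$ and a dependent eliminator (whose motive depends on the boolean under the identity modality only), and a universe; for each modality $\xi : a\to b$ a lock $\Gamma.\{\xi\}$ taking contexts at mode $b$ to contexts at mode $a$ (with $\Gamma.\{1\}=\Gamma$, $\Gamma.\{\xi\}.\{\zeta\}=\Gamma.\{\xi\circ\zeta\}$); key substitutions for 2-cells; modal types $\langle\xi\mid A\rangle$ at mode $b$ for $A$ at mode $a$ in $\Gamma.\{\xi\}$, with introduction $\mathsf{mod}_\xi$ and eliminator $\mathsf{let}_\zeta\ \mathsf{mod}_\xi(x)\leftarrow M_0\ \mathsf{in}\ M_1$ ($\beta$, no $\eta$). An equivalence of types $X\simeq Y$ means functions $X\to Y$, $Y\to X$ whose composites are pointwise propositionally equal (via identity types) to the identities. *)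

(* Defs.v *)
Set Implicit Arguments.
Unset Strict Implicit.
Unset Printing Implicit Defensive.

Definition cast2 {X : Type} (C : X -> X -> Type) {f f' g g' : X}
    (p : f = f') (q : g = g') (x : C f g) : C f' g' :=
  match p in _ = f1, q in _ = g1 return C f1 g1 with
  | eq_refl, eq_refl => x
  end.
Arguments cast2 {X} C {f f' g g'} p q x.

(** A strict 2-category: 1-cells compose strictly, up to [=].  2-cells carry an equivalence relation
    [cell_eq], which plays the role of equality of 2-cells; this lets free
    2-categories be given by 2-cell expressions modulo equations.
    [hcomp u v] is [u] after [v], and [vcell y x] is [y] after [x]. *)
Record mode_theory : Type := ModeTheory {
  mode : Type;
  hom : mode -> mode -> Type;
  hid : forall a, hom a a;
  hcomp : forall a b c, hom b c -> hom a b -> hom a c;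
  hcomp_id_l : forall a b (f : hom a b), hcomp (hid b) f = f;
  hcomp_id_r : forall a b (f : hom a b), hcomp f (hid a) = f;
  hcomp_assoc : forall a b c d (h : hom c d) (g : hom b c) (f : hom a b),
    hcomp h (hcomp g f) = hcomp (hcomp h g) f;

  cell : forall a b, hom a b -> hom a b -> Type;
  cell_eq : forall a b (f g : hom a b), cell f g -> cell f g -> Prop;
  idcell : forall a b (f : hom a b), cell f f;
  vcell : forall a b (f g h : hom a b), cell g h -> cell f g -> cell f h;
  hcell : forall a b c (g g' : hom b c) (f f' : hom a b),
    cell g g' -> cell f f' -> cell (hcomp g f) (hcomp g' f');

  cell_eq_refl : forall a b (f g : hom a b) (x : cell f g), cell_eq x x;
  cell_eq_sym : forall a b (f g : hom a b) (x y : cell f g),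
    cell_eq x y -> cell_eq y x;
  cell_eq_trans : forall a b (f g : hom a b) (x y z : cell f g),
    cell_eq x y -> cell_eq y z -> cell_eq x z;
  vcell_eq : forall a b (f g h : hom a b) (y y' : cell g h) (x x' : cell f g),
    cell_eq y y' -> cell_eq x x' -> cell_eq (vcell y x) (vcell y' x');
  hcell_eq : forall a b c (g g' : hom b c) (f f' : hom a b)
      (y y' : cell g g') (x x' : cell f f'),
    cell_eq y y' -> cell_eq x x' -> cell_eq (hcell y x) (hcell y' x');

  vcell_id_l : forall a b (f g : hom a b) (x : cell f g),
    cell_eq (vcell (idcell g) x) x;
  vcell_id_r : forall a b (f g : hom a b) (x : cell f g),
    cell_eq (vcell x (idcell f)) x;
  vcell_assoc : forall a b (f g h k : hom a b)
      (z : cell h k) (y : cell g h) (x : cell f g),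
    cell_eq (vcell z (vcell y x)) (vcell (vcell z y) x);
  hcell_id : forall a b c (g : hom b c) (f : hom a b),
    cell_eq (hcell (idcell g) (idcell f)) (idcell (hcomp g f));
  hcell_vcell : forall a b c (g g' g'' : hom b c) (f f' f'' : hom a b)
      (y' : cell g' g'') (y : cell g g') (x' : cell f' f'') (x : cell f f'),
    cell_eq (hcell (vcell y' y) (vcell x' x)) (vcell (hcell y' x') (hcell y x));
  hcell_id_l : forall a b (f g : hom a b) (x : cell f g),
    cell_eq (cast2 (@cell a b) (hcomp_id_l f) (hcomp_id_l g)
               (hcell (idcell (hid b)) x)) x;
  hcell_id_r : forall a b (f g : hom a b) (x : cell f g),
    cell_eq (cast2 (@cell a b) (hcomp_id_r f) (hcomp_id_r g)
               (hcell x (idcell (hid a)))) x;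
  hcell_assoc : forall a b c d (h h' : hom c d) (g g' : hom b c) (f f' : hom a b)
      (z : cell h h') (y : cell g g') (x : cell f f'),
    cell_eq (cast2 (@cell a d) (hcomp_assoc h g f) (hcomp_assoc h' g' f')
               (hcell z (hcell y x)))
            (hcell (hcell z y) x)
}.

Arguments hom {_} _ _.
Arguments hid {_} _.
Arguments hcomp {_ a b c} _ _.
Arguments cell {_ a b} _ _.
Arguments cell_eq {_ a b f g} _ _.
Arguments idcell {_ a b} _.
Arguments vcell {_ a b f g h} _ _.
Arguments hcell {_ a b c g g' f f'} _ _.

Inductive adj_mode : Type := mode_m | mode_n.

Inductive adj_gen : adj_mode -> adj_mode -> Type :=
| gen_nu : adj_gen mode_m mode_n
| gen_mu : adj_gen mode_n mode_m.

(** Paths of generators; the head of the path is applied last. *)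
Inductive adj_hom : adj_mode -> adj_mode -> Type :=
| adj_nil : forall a, adj_hom a a
| adj_cons : forall a b c, adj_gen b c -> adj_hom a b -> adj_hom a c.

Fixpoint adj_comp {a b c : adj_mode} (g : adj_hom b c) {struct g} :
    adj_hom a b -> adj_hom a c :=
  match g in adj_hom b0 c0 return adj_hom a b0 -> adj_hom a c0 with
  | adj_nil _ => fun f => f
  | adj_cons x g' => fun f => adj_cons x (adj_comp g' f)
  end.

Lemma adj_comp_id_l a b (f : adj_hom a b) : adj_comp (adj_nil b) f = f.
Proof. reflexivity. Defined.

Lemma adj_comp_id_r a b (f : adj_hom a b) : adj_comp f (adj_nil a) = f.
Proof.
  induction f as [a|a b c x f IH]; simpl.
  - reflexivity.
  - exact (f_equal (adj_cons x) IH).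
Defined.

Lemma adj_comp_assoc a b c d (h : adj_hom c d) (g : adj_hom b c) (f : adj_hom a b) :
  adj_comp h (adj_comp g f) = adj_comp (adj_comp h g) f.
Proof.
  revert a b g f; induction h as [c|c d e x h IH]; intros a b g f; simpl.
  - reflexivity.
  - exact (f_equal (adj_cons x) (IH a b g f)).
Defined.

Definition adj_nu : adj_hom mode_m mode_n := adj_cons gen_nu (adj_nil mode_m).
Definition adj_mu : adj_hom mode_n mode_m := adj_cons gen_mu (adj_nil mode_n).

Inductive adj_cell : forall a b, adj_hom a b -> adj_hom a b -> Type :=
| adj_id : forall a b (f : adj_hom a b), adj_cell f f
| adj_v : forall a b (f g h : adj_hom a b),
    adj_cell g h -> adj_cell f g -> adj_cell f h
| adj_h : forall a b c (g g' : adj_hom b c) (f f' : adj_hom a b),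
    adj_cell g g' -> adj_cell f f' -> adj_cell (adj_comp g f) (adj_comp g' f')
| adj_eta : adj_cell (adj_nil mode_m) (adj_comp adj_mu adj_nu)
| adj_eps : adj_cell (adj_comp adj_nu adj_mu) (adj_nil mode_n).

(** The congruence generated by the 2-category laws and the triangle identities.
    In the latter the 1-cells are concrete paths, so that, e.g.,
    [nu o (mu o nu)] and [(nu o mu) o nu] are convertible. *)
Inductive adj_cell_eq : forall a b (f g : adj_hom a b),
    adj_cell f g -> adj_cell f g -> Prop :=
| adj_eq_refl : forall a b (f g : adj_hom a b) (x : adj_cell f g), adj_cell_eq x x
| adj_eq_sym : forall a b (f g : adj_hom a b) (x y : adj_cell f g),
    adj_cell_eq x y -> adj_cell_eq y x
| adj_eq_trans : forall a b (f g : adj_hom a b) (x y z : adj_cell f g),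
    adj_cell_eq x y -> adj_cell_eq y z -> adj_cell_eq x z
| adj_v_eq : forall a b (f g h : adj_hom a b)
      (y y' : adj_cell g h) (x x' : adj_cell f g),
    adj_cell_eq y y' -> adj_cell_eq x x' -> adj_cell_eq (adj_v y x) (adj_v y' x')
| adj_h_eq : forall a b c (g g' : adj_hom b c) (f f' : adj_hom a b)
      (y y' : adj_cell g g') (x x' : adj_cell f f'),
    adj_cell_eq y y' -> adj_cell_eq x x' -> adj_cell_eq (adj_h y x) (adj_h y' x')
| adj_v_id_l : forall a b (f g : adj_hom a b) (x : adj_cell f g),
    adj_cell_eq (adj_v (adj_id g) x) x
| adj_v_id_r : forall a b (f g : adj_hom a b) (x : adj_cell f g),
    adj_cell_eq (adj_v x (adj_id f)) x
| adj_v_assoc : forall a b (f g h k : adj_hom a b)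
      (z : adj_cell h k) (y : adj_cell g h) (x : adj_cell f g),
    adj_cell_eq (adj_v z (adj_v y x)) (adj_v (adj_v z y) x)
| adj_h_id : forall a b c (g : adj_hom b c) (f : adj_hom a b),
    adj_cell_eq (adj_h (adj_id g) (adj_id f)) (adj_id (adj_comp g f))
| adj_h_v : forall a b c (g g' g'' : adj_hom b c) (f f' f'' : adj_hom a b)
      (y' : adj_cell g' g'') (y : adj_cell g g')
      (x' : adj_cell f' f'') (x : adj_cell f f'),
    adj_cell_eq (adj_h (adj_v y' y) (adj_v x' x)) (adj_v (adj_h y' x') (adj_h y x))
| adj_h_id_l : forall a b (f g : adj_hom a b) (x : adj_cell f g),
    adj_cell_eq (cast2 (@adj_cell a b) (adj_comp_id_l f) (adj_comp_id_l g)
                   (adj_h (adj_id (adj_nil b)) x)) x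
| adj_h_id_r : forall a b (f g : adj_hom a b) (x : adj_cell f g),
    adj_cell_eq (cast2 (@adj_cell a b) (adj_comp_id_r f) (adj_comp_id_r g)
                   (adj_h x (adj_id (adj_nil a)))) x
| adj_h_assoc : forall a b c d (h h' : adj_hom c d) (g g' : adj_hom b c)
      (f f' : adj_hom a b) (z : adj_cell h h') (y : adj_cell g g') (x : adj_cell f f'),
    adj_cell_eq (cast2 (@adj_cell a d) (adj_comp_assoc h g f) (adj_comp_assoc h' g' f')
                   (adj_h z (adj_h y x)))
                (adj_h (adj_h z y) x)
| adj_triangle_nu :
    @adj_cell_eq mode_m mode_n adj_nu adj_nu
      (adj_v (adj_h adj_eps (adj_id adj_nu)) (adj_h (adj_id adj_nu) adj_eta))
      (adj_id adj_nu)
| adj_triangle_mu :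
    @adj_cell_eq mode_n mode_m adj_mu adj_mu
      (adj_v (adj_h (adj_id adj_mu) adj_eps) (adj_h adj_eta (adj_id adj_mu)))
      (adj_id adj_mu).

Definition walking_adj : mode_theory :=
  @ModeTheory adj_mode adj_hom adj_nil (@adj_comp)
    adj_comp_id_l adj_comp_id_r adj_comp_assoc
    adj_cell adj_cell_eq adj_id adj_v adj_h
    adj_eq_refl adj_eq_sym adj_eq_trans adj_v_eq adj_h_eq
    adj_v_id_l adj_v_id_r adj_v_assoc adj_h_id adj_h_v
    adj_h_id_l adj_h_id_r adj_h_assoc.

Definition m : mode walking_adj := mode_m.
Definition n : mode walking_adj := mode_n.
Definition nu : hom m n := adj_nu.
Definition mu : hom n m := adj_mu.

(** Names are replaced by explicit substitutions: [tm_var] is the last variable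
    of [G.(u|A).{u}], and further variables are obtained by weakening [sb_wk].
    The syntax is indexed by the mode at which the expression lives. *)

Inductive ctx (T : mode_theory) : mode T -> Type :=
| cx_emp : forall a, ctx a
| cx_lock : forall a b, hom a b -> ctx b -> ctx a
| cx_ext : forall a b, hom a b -> ctx b -> ty a -> ctx b

with ty (T : mode_theory) : mode T -> Type :=
| ty_sub : forall a, ty a -> sub a -> ty a
| ty_bool : forall a, ty a
| ty_univ : forall a, ty a
| ty_el : forall a, tm a -> ty a
| ty_id : forall a, ty a -> tm a -> tm a -> ty a
| ty_sigma : forall a, ty a -> ty a -> ty a
| ty_pi : forall a b, hom a b -> ty a -> ty b -> ty b
| ty_mod : forall a b, hom a b -> ty a -> ty b

with tm (T : mode_theory) : mode T -> Type :=
| tm_sub : forall a, tm a -> sub a -> tm a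
| tm_var : forall a, tm a
| tm_true : forall a, tm a
| tm_false : forall a, tm a
| tm_if : forall a, ty a -> tm a -> tm a -> tm a -> tm a
| tm_pair : forall a, tm a -> tm a -> tm a
| tm_fst : forall a, tm a -> tm a
| tm_snd : forall a, tm a -> tm a
| tm_lam : forall a b, hom a b -> tm b -> tm b
| tm_app : forall a b, hom a b -> tm b -> tm a -> tm b
| tm_refl : forall a, tm a -> tm a
| tm_J : forall a, ty a -> tm a -> tm a -> tm a
| tm_mod : forall a b, hom a b -> tm a -> tm b
| tm_let : forall a b c, hom b c -> hom a b -> ty c -> tm b -> tm c -> tm c
| tm_code : forall a, ty a -> tm a

with sub (T : mode_theory) : mode T -> Type :=
| sb_emp : forall a, sub a
| sb_id : forall a, sub a
| sb_comp : forall a, sub a -> sub a -> sub a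
| sb_wk : forall a, sub a
| sb_ext : forall a b, hom a b -> sub b -> tm a -> sub b
| sb_lock : forall a b, hom a b -> sub b -> sub a
| sb_key : forall a b (u v : hom a b), cell u v -> ctx b -> sub a.

Arguments cx_emp {T} a.
Arguments cx_lock {T a b} _ _.
Arguments cx_ext {T a b} _ _ _.
Arguments ty_sub {T a} _ _.
Arguments ty_bool {T} a.
Arguments ty_univ {T} a.
Arguments ty_el {T a} _.
Arguments ty_id {T a} _ _ _.
Arguments ty_sigma {T a} _ _.
Arguments ty_pi {T a b} _ _ _.
Arguments ty_mod {T a b} _ _.
Arguments tm_sub {T a} _ _.
Arguments tm_var {T} a.
Arguments tm_true {T} a.
Arguments tm_false {T} a.
Arguments tm_if {T a} _ _ _ _.
Arguments tm_pair {T a} _ _.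
Arguments tm_fst {T a} _.
Arguments tm_snd {T a} _.
Arguments tm_lam {T a b} _ _.
Arguments tm_app {T a b} _ _ _.
Arguments tm_refl {T a} _.
Arguments tm_J {T a} _ _ _.
Arguments tm_mod {T a b} _ _.
Arguments tm_let {T a b c} _ _ _ _ _.
Arguments tm_code {T a} _.
Arguments sb_emp {T} a.
Arguments sb_id {T} a.
Arguments sb_comp {T a} _ _.
Arguments sb_wk {T} a.
Arguments sb_ext {T a b} _ _ _.
Arguments sb_lock {T a b} _ _.
Arguments sb_key {T a b u v} _ _.

(** [id.t], a substitution from [G] to [G.(u|A)]. *)
Definition sb_inst {T : mode_theory} {a b : mode T} (u : hom a b) (t : tm a) : sub b :=
  sb_ext u (sb_id b) t.

(** [(d o wk).v], a substitution from [G.(u|A[d.{u}])] to [H.(u|A)]. *)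
Definition sb_lift {T : mode_theory} {a b : mode T} (u : hom a b) (d : sub b) : sub b :=
  sb_ext u (sb_comp d (sb_wk b)) (tm_var a).

(** The context [G.(x : A).(y : A).(p : Id x y)] of motives for [J]. *)
Definition cx_J {T : mode_theory} {a : mode T} (G : ctx a) (A : ty a) : ctx a :=
  let w := sb_wk a in
  cx_ext (hid a)
    (cx_ext (hid a) (cx_ext (hid a) G A) (ty_sub A w))
    (ty_id (ty_sub (ty_sub A w) w) (tm_sub (tm_var a) w) (tm_var a)).

Definition sb_J {T : mode_theory} {a : mode T} (d : sub a) (x y p : tm a) : sub a :=
  sb_ext (hid a) (sb_ext (hid a) (sb_ext (hid a) d x) y) p.

(** Types come in two sizes; terms and context entries have large types, small
    types are (implicitly) large, and the universe classifies small types. *)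

Inductive size : Type := Small | Large.

Inductive wf_ctx (T : mode_theory) : forall a : mode T, ctx a -> Prop :=
| wf_cx_emp : forall a, wf_ctx (cx_emp a)
| wf_cx_lock : forall a b (u : hom a b) (G : ctx b),
    wf_ctx G -> wf_ctx (cx_lock u G)
| wf_cx_ext : forall a b (u : hom a b) (G : ctx b) (A : ty a),
    wf_ctx G -> wf_ty (cx_lock u G) Large A -> wf_ctx (cx_ext u G A)

with eq_ctx (T : mode_theory) : forall a : mode T, ctx a -> ctx a -> Prop :=
| eq_cx_refl : forall a (G : ctx a), wf_ctx G -> eq_ctx G G
| eq_cx_sym : forall a (G H : ctx a), eq_ctx G H -> eq_ctx H G
| eq_cx_trans : forall a (G H K : ctx a), eq_ctx G H -> eq_ctx H K -> eq_ctx G K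
| eq_cx_lock_id : forall a (G : ctx a), wf_ctx G -> eq_ctx (cx_lock (hid a) G) G
| eq_cx_lock_comp : forall a b c (u : hom b c) (v : hom a b) (G : ctx c),
    wf_ctx G -> eq_ctx (cx_lock v (cx_lock u G)) (cx_lock (hcomp u v) G)
| eq_cx_lock : forall a b (u : hom a b) (G H : ctx b),
    eq_ctx G H -> eq_ctx (cx_lock u G) (cx_lock u H)
| eq_cx_ext : forall a b (u : hom a b) (G H : ctx b) (A B : ty a),
    eq_ctx G H -> eq_ty (cx_lock u G) Large A B ->
    eq_ctx (cx_ext u G A) (cx_ext u H B)

with wf_ty (T : mode_theory) : forall a : mode T, ctx a -> size -> ty a -> Prop :=
| wf_ty_conv : forall a (G H : ctx a) s A,
    eq_ctx G H -> wf_ty G s A -> wf_ty H s A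
| wf_ty_cum : forall a (G : ctx a) A, wf_ty G Small A -> wf_ty G Large A
| wf_ty_sub : forall a (G H : ctx a) s A d,
    wf_sub G d H -> wf_ty H s A -> wf_ty G s (ty_sub A d)
| wf_ty_bool : forall a (G : ctx a), wf_ctx G -> wf_ty G Small (ty_bool a)
| wf_ty_univ : forall a (G : ctx a), wf_ctx G -> wf_ty G Large (ty_univ a)
| wf_ty_el : forall a (G : ctx a) M,
    wf_tm G M (ty_univ a) -> wf_ty G Small (ty_el M)
| wf_ty_id : forall a (G : ctx a) s A M N,
    wf_ty G s A -> wf_tm G M A -> wf_tm G N A -> wf_ty G s (ty_id A M N)
| wf_ty_sigma : forall a (G : ctx a) s A B,
    wf_ty G s A -> wf_ty (cx_ext (hid a) G A) s B -> wf_ty G s (ty_sigma A B)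
| wf_ty_pi : forall a b (u : hom a b) (G : ctx b) s A B,
    wf_ty (cx_lock u G) s A -> wf_ty (cx_ext u G A) s B -> wf_ty G s (ty_pi u A B)
| wf_ty_mod : forall a b (u : hom a b) (G : ctx b) s A,
    wf_ctx G -> wf_ty (cx_lock u G) s A -> wf_ty G s (ty_mod u A)

with eq_ty (T : mode_theory) :
    forall a : mode T, ctx a -> size -> ty a -> ty a -> Prop :=
| eq_ty_refl : forall a (G : ctx a) s A, wf_ty G s A -> eq_ty G s A A
| eq_ty_sym : forall a (G : ctx a) s A B, eq_ty G s A B -> eq_ty G s B A
| eq_ty_trans : forall a (G : ctx a) s A B C,
    eq_ty G s A B -> eq_ty G s B C -> eq_ty G s A C
| eq_ty_conv : forall a (G H : ctx a) s A B,
    eq_ctx G H -> eq_ty G s A B -> eq_ty H s A B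
| eq_ty_cum : forall a (G : ctx a) A B, eq_ty G Small A B -> eq_ty G Large A B
| eq_ty_code : forall a (G : ctx a) A,
    wf_ty G Small A -> eq_ty G Small (ty_el (tm_code A)) A
| eq_ty_sub : forall a (G H : ctx a) s A B d e,
    eq_sub G d e H -> eq_ty H s A B -> eq_ty G s (ty_sub A d) (ty_sub B e)
| eq_ty_el : forall a (G : ctx a) M N,
    eq_tm G M N (ty_univ a) -> eq_ty G Small (ty_el M) (ty_el N)
| eq_ty_id : forall a (G : ctx a) s A A' M M' N N',
    eq_ty G s A A' -> eq_tm G M M' A -> eq_tm G N N' A ->
    eq_ty G s (ty_id A M N) (ty_id A' M' N')
| eq_ty_sigma : forall a (G : ctx a) s A A' B B',
    eq_ty G s A A' -> eq_ty (cx_ext (hid a) G A) s B B' ->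
    eq_ty G s (ty_sigma A B) (ty_sigma A' B')
| eq_ty_pi : forall a b (u : hom a b) (G : ctx b) s A A' B B',
    eq_ty (cx_lock u G) s A A' -> eq_ty (cx_ext u G A) s B B' ->
    eq_ty G s (ty_pi u A B) (ty_pi u A' B')
| eq_ty_mod : forall a b (u : hom a b) (G : ctx b) s A A',
    wf_ctx G -> eq_ty (cx_lock u G) s A A' ->
    eq_ty G s (ty_mod u A) (ty_mod u A')
| eq_ty_sub_id : forall a (G : ctx a) s A,
    wf_ty G s A -> eq_ty G s (ty_sub A (sb_id a)) A
| eq_ty_sub_comp : forall a (G H K : ctx a) s A d e,
    wf_sub G e H -> wf_sub H d K -> wf_ty K s A ->
    eq_ty G s (ty_sub (ty_sub A d) e) (ty_sub A (sb_comp d e))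
| eq_ty_sub_bool : forall a (G H : ctx a) d,
    wf_sub G d H -> eq_ty G Small (ty_sub (ty_bool a) d) (ty_bool a)
| eq_ty_sub_univ : forall a (G H : ctx a) d,
    wf_sub G d H -> eq_ty G Large (ty_sub (ty_univ a) d) (ty_univ a)
| eq_ty_sub_el : forall a (G H : ctx a) M d,
    wf_sub G d H -> wf_tm H M (ty_univ a) ->
    eq_ty G Small (ty_sub (ty_el M) d) (ty_el (tm_sub M d))
| eq_ty_sub_idt : forall a (G H : ctx a) s A M N d,
    wf_sub G d H -> wf_ty H s A -> wf_tm H M A -> wf_tm H N A ->
    eq_ty G s (ty_sub (ty_id A M N) d)
              (ty_id (ty_sub A d) (tm_sub M d) (tm_sub N d))
| eq_ty_sub_sigma : forall a (G H : ctx a) s A B d,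
    wf_sub G d H -> wf_ty H s A -> wf_ty (cx_ext (hid a) H A) s B ->
    eq_ty G s (ty_sub (ty_sigma A B) d)
              (ty_sigma (ty_sub A d) (ty_sub B (sb_lift (hid a) d)))
| eq_ty_sub_pi : forall a b (u : hom a b) (G H : ctx b) s A B d,
    wf_sub G d H -> wf_ty (cx_lock u H) s A -> wf_ty (cx_ext u H A) s B ->
    eq_ty G s (ty_sub (ty_pi u A B) d)
              (ty_pi u (ty_sub A (sb_lock u d)) (ty_sub B (sb_lift u d)))
| eq_ty_sub_mod : forall a b (u : hom a b) (G H : ctx b) s A d,
    wf_sub G d H -> wf_ty (cx_lock u H) s A ->
    eq_ty G s (ty_sub (ty_mod u A) d) (ty_mod u (ty_sub A (sb_lock u d)))

with wf_tm (T : mode_theory) : forall a : mode T, ctx a -> tm a -> ty a -> Prop :=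
| wf_tm_conv : forall a (G H : ctx a) M A B,
    eq_ctx G H -> eq_ty G Large A B -> wf_tm G M A -> wf_tm H M B
| wf_tm_sub : forall a (G H : ctx a) M A d,
    wf_sub G d H -> wf_tm H M A -> wf_tm G (tm_sub M d) (ty_sub A d)
| wf_tm_var : forall a b (u : hom a b) (G : ctx b) A,
    wf_ctx G -> wf_ty (cx_lock u G) Large A ->
    wf_tm (cx_lock u (cx_ext u G A)) (tm_var a) (ty_sub A (sb_lock u (sb_wk b)))
| wf_tm_true : forall a (G : ctx a), wf_ctx G -> wf_tm G (tm_true a) (ty_bool a)
| wf_tm_false : forall a (G : ctx a), wf_ctx G -> wf_tm G (tm_false a) (ty_bool a)
| wf_tm_if : forall a (G : ctx a) A Mt Mf N,
    wf_ty (cx_ext (hid a) G (ty_bool a)) Large A ->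
    wf_tm G Mt (ty_sub A (sb_inst (hid a) (tm_true a))) ->
    wf_tm G Mf (ty_sub A (sb_inst (hid a) (tm_false a))) ->
    wf_tm G N (ty_bool a) ->
    wf_tm G (tm_if A Mt Mf N) (ty_sub A (sb_inst (hid a) N))
| wf_tm_pair : forall a (G : ctx a) A B M N,
    wf_ty (cx_ext (hid a) G A) Large B ->
    wf_tm G M A -> wf_tm G N (ty_sub B (sb_inst (hid a) M)) ->
    wf_tm G (tm_pair M N) (ty_sigma A B)
| wf_tm_fst : forall a (G : ctx a) A B M,
    wf_tm G M (ty_sigma A B) -> wf_tm G (tm_fst M) A
| wf_tm_snd : forall a (G : ctx a) A B M,
    wf_tm G M (ty_sigma A B) ->
    wf_tm G (tm_snd M) (ty_sub B (sb_inst (hid a) (tm_fst M)))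
| wf_tm_lam : forall a b (u : hom a b) (G : ctx b) A B M,
    wf_ty (cx_lock u G) Large A -> wf_tm (cx_ext u G A) M B ->
    wf_tm G (tm_lam u M) (ty_pi u A B)
| wf_tm_app : forall a b (u : hom a b) (G : ctx b) A B M N,
    wf_tm G M (ty_pi u A B) -> wf_tm (cx_lock u G) N A ->
    wf_tm G (tm_app u M N) (ty_sub B (sb_inst u N))
| wf_tm_refl : forall a (G : ctx a) A M,
    wf_tm G M A -> wf_tm G (tm_refl M) (ty_id A M M)
| wf_tm_J : forall a (G : ctx a) A B M N0 N1 P,
    wf_ty (cx_J G A) Large B ->
    wf_tm (cx_ext (hid a) G A) M
      (ty_sub B (sb_J (sb_wk a) (tm_var a) (tm_var a) (tm_refl (tm_var a)))) ->
    wf_tm G N0 A -> wf_tm G N1 A -> wf_tm G P (ty_id A N0 N1) ->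
    wf_tm G (tm_J B M P) (ty_sub B (sb_J (sb_id a) N0 N1 P))
| wf_tm_mod : forall a b (u : hom a b) (G : ctx b) A M,
    wf_ctx G -> wf_tm (cx_lock u G) M A -> wf_tm G (tm_mod u M) (ty_mod u A)
| wf_tm_let : forall a b c (v : hom b c) (u : hom a b) (G : ctx c) A B M0 M1,
    wf_ty (cx_ext v G (ty_mod u A)) Large B ->
    wf_tm (cx_lock v G) M0 (ty_mod u A) ->
    wf_tm (cx_ext (hcomp v u) G A) M1
      (ty_sub B (sb_ext v (sb_wk c) (tm_mod u (tm_var a)))) ->
    wf_tm G (tm_let v u B M0 M1) (ty_sub B (sb_inst v M0))
| wf_tm_code : forall a (G : ctx a) A,
    wf_ty G Small A -> wf_tm G (tm_code A) (ty_univ a)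

with eq_tm (T : mode_theory) :
    forall a : mode T, ctx a -> tm a -> tm a -> ty a -> Prop :=
| eq_tm_refl : forall a (G : ctx a) M A, wf_tm G M A -> eq_tm G M M A
| eq_tm_sym : forall a (G : ctx a) M N A, eq_tm G M N A -> eq_tm G N M A
| eq_tm_trans : forall a (G : ctx a) M N P A,
    eq_tm G M N A -> eq_tm G N P A -> eq_tm G M P A
| eq_tm_conv : forall a (G H : ctx a) M N A B,
    eq_ctx G H -> eq_ty G Large A B -> eq_tm G M N A -> eq_tm H M N B
| eq_tm_true_beta : forall a (G : ctx a) A Mt Mf,
    wf_ty (cx_ext (hid a) G (ty_bool a)) Large A ->
    wf_tm G Mt (ty_sub A (sb_inst (hid a) (tm_true a))) ->
    wf_tm G Mf (ty_sub A (sb_inst (hid a) (tm_false a))) ->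
    eq_tm G (tm_if A Mt Mf (tm_true a)) Mt
      (ty_sub A (sb_inst (hid a) (tm_true a)))
| eq_tm_false_beta : forall a (G : ctx a) A Mt Mf,
    wf_ty (cx_ext (hid a) G (ty_bool a)) Large A ->
    wf_tm G Mt (ty_sub A (sb_inst (hid a) (tm_true a))) ->
    wf_tm G Mf (ty_sub A (sb_inst (hid a) (tm_false a))) ->
    eq_tm G (tm_if A Mt Mf (tm_false a)) Mf
      (ty_sub A (sb_inst (hid a) (tm_false a)))
| eq_tm_fst_beta : forall a (G : ctx a) A B M N,
    wf_ty (cx_ext (hid a) G A) Large B ->
    wf_tm G M A -> wf_tm G N (ty_sub B (sb_inst (hid a) M)) ->
    eq_tm G (tm_fst (tm_pair M N)) M A
| eq_tm_snd_beta : forall a (G : ctx a) A B M N,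
    wf_ty (cx_ext (hid a) G A) Large B ->
    wf_tm G M A -> wf_tm G N (ty_sub B (sb_inst (hid a) M)) ->
    eq_tm G (tm_snd (tm_pair M N)) N (ty_sub B (sb_inst (hid a) M))
| eq_tm_pair_eta : forall a (G : ctx a) A B M,
    wf_tm G M (ty_sigma A B) ->
    eq_tm G M (tm_pair (tm_fst M) (tm_snd M)) (ty_sigma A B)
| eq_tm_lam_beta : forall a b (u : hom a b) (G : ctx b) A B M N,
    wf_tm (cx_ext u G A) M B -> wf_tm (cx_lock u G) N A ->
    eq_tm G (tm_app u (tm_lam u M) N) (tm_sub M (sb_inst u N))
      (ty_sub B (sb_inst u N))
| eq_tm_lam_eta : forall a b (u : hom a b) (G : ctx b) A B M,
    wf_tm G M (ty_pi u A B) ->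
    eq_tm G M (tm_lam u (tm_app u (tm_sub M (sb_wk b)) (tm_var a))) (ty_pi u A B)
| eq_tm_J_beta : forall a (G : ctx a) A B M N,
    wf_ty (cx_J G A) Large B ->
    wf_tm (cx_ext (hid a) G A) M
      (ty_sub B (sb_J (sb_wk a) (tm_var a) (tm_var a) (tm_refl (tm_var a)))) ->
    wf_tm G N A ->
    eq_tm G (tm_J B M (tm_refl N)) (tm_sub M (sb_inst (hid a) N))
      (ty_sub B (sb_J (sb_id a) N N (tm_refl N)))
| eq_tm_let_beta : forall a b c (v : hom b c) (u : hom a b) (G : ctx c) A B M0 M1,
    wf_ty (cx_ext v G (ty_mod u A)) Large B ->
    wf_tm (cx_lock (hcomp v u) G) M0 A ->
    wf_tm (cx_ext (hcomp v u) G A) M1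
      (ty_sub B (sb_ext v (sb_wk c) (tm_mod u (tm_var a)))) ->
    eq_tm G (tm_let v u B (tm_mod u M0) M1) (tm_sub M1 (sb_inst (hcomp v u) M0))
      (ty_sub B (sb_inst v (tm_mod u M0)))
| eq_tm_code_el : forall a (G : ctx a) M,
    wf_tm G M (ty_univ a) -> eq_tm G (tm_code (ty_el M)) M (ty_univ a)
| eq_tm_sub : forall a (G H : ctx a) M N A d e,
    eq_sub G d e H -> eq_tm H M N A ->
    eq_tm G (tm_sub M d) (tm_sub N e) (ty_sub A d)
| eq_tm_if : forall a (G : ctx a) A A' Mt Mt' Mf Mf' N N',
    eq_ty (cx_ext (hid a) G (ty_bool a)) Large A A' ->
    eq_tm G Mt Mt' (ty_sub A (sb_inst (hid a) (tm_true a))) ->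
    eq_tm G Mf Mf' (ty_sub A (sb_inst (hid a) (tm_false a))) ->
    eq_tm G N N' (ty_bool a) ->
    eq_tm G (tm_if A Mt Mf N) (tm_if A' Mt' Mf' N') (ty_sub A (sb_inst (hid a) N))
| eq_tm_pair : forall a (G : ctx a) A B M M' N N',
    wf_ty (cx_ext (hid a) G A) Large B ->
    eq_tm G M M' A -> eq_tm G N N' (ty_sub B (sb_inst (hid a) M)) ->
    eq_tm G (tm_pair M N) (tm_pair M' N') (ty_sigma A B)
| eq_tm_fst : forall a (G : ctx a) A B M M',
    eq_tm G M M' (ty_sigma A B) -> eq_tm G (tm_fst M) (tm_fst M') A
| eq_tm_snd : forall a (G : ctx a) A B M M',
    eq_tm G M M' (ty_sigma A B) ->
    eq_tm G (tm_snd M) (tm_snd M') (ty_sub B (sb_inst (hid a) (tm_fst M)))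
| eq_tm_lam : forall a b (u : hom a b) (G : ctx b) A B M M',
    wf_ty (cx_lock u G) Large A -> eq_tm (cx_ext u G A) M M' B ->
    eq_tm G (tm_lam u M) (tm_lam u M') (ty_pi u A B)
| eq_tm_app : forall a b (u : hom a b) (G : ctx b) A B M M' N N',
    eq_tm G M M' (ty_pi u A B) -> eq_tm (cx_lock u G) N N' A ->
    eq_tm G (tm_app u M N) (tm_app u M' N') (ty_sub B (sb_inst u N))
| eq_tm_refl_cong : forall a (G : ctx a) A M M',
    eq_tm G M M' A -> eq_tm G (tm_refl M) (tm_refl M') (ty_id A M M)
| eq_tm_J : forall a (G : ctx a) A B B' M M' N0 N1 P P',
    eq_ty (cx_J G A) Large B B' ->
    eq_tm (cx_ext (hid a) G A) M M'
      (ty_sub B (sb_J (sb_wk a) (tm_var a) (tm_var a) (tm_refl (tm_var a)))) ->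
    wf_tm G N0 A -> wf_tm G N1 A -> eq_tm G P P' (ty_id A N0 N1) ->
    eq_tm G (tm_J B M P) (tm_J B' M' P') (ty_sub B (sb_J (sb_id a) N0 N1 P))
| eq_tm_mod : forall a b (u : hom a b) (G : ctx b) A M M',
    wf_ctx G -> eq_tm (cx_lock u G) M M' A ->
    eq_tm G (tm_mod u M) (tm_mod u M') (ty_mod u A)
| eq_tm_let : forall a b c (v : hom b c) (u : hom a b) (G : ctx c) A B B' M0 M0' M1 M1',
    eq_ty (cx_ext v G (ty_mod u A)) Large B B' ->
    eq_tm (cx_lock v G) M0 M0' (ty_mod u A) ->
    eq_tm (cx_ext (hcomp v u) G A) M1 M1'
      (ty_sub B (sb_ext v (sb_wk c) (tm_mod u (tm_var a)))) ->
    eq_tm G (tm_let v u B M0 M1) (tm_let v u B' M0' M1') (ty_sub B (sb_inst v M0))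
| eq_tm_code : forall a (G : ctx a) A A',
    eq_ty G Small A A' -> eq_tm G (tm_code A) (tm_code A') (ty_univ a)
| eq_tm_sub_id : forall a (G : ctx a) M A,
    wf_tm G M A -> eq_tm G (tm_sub M (sb_id a)) M A
| eq_tm_sub_comp : forall a (G H K : ctx a) M A d e,
    wf_sub G e H -> wf_sub H d K -> wf_tm K M A ->
    eq_tm G (tm_sub (tm_sub M d) e) (tm_sub M (sb_comp d e)) (ty_sub A (sb_comp d e))
| eq_tm_var_ext : forall a b (u : hom a b) (G H : ctx b) A M d,
    wf_sub G d H -> wf_ty (cx_lock u H) Large A ->
    wf_tm (cx_lock u G) M (ty_sub A (sb_lock u d)) ->
    eq_tm (cx_lock u G) (tm_sub (tm_var a) (sb_lock u (sb_ext u d M))) M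
      (ty_sub A (sb_lock u d))
| eq_tm_sub_true : forall a (G H : ctx a) d,
    wf_sub G d H -> eq_tm G (tm_sub (tm_true a) d) (tm_true a) (ty_bool a)
| eq_tm_sub_false : forall a (G H : ctx a) d,
    wf_sub G d H -> eq_tm G (tm_sub (tm_false a) d) (tm_false a) (ty_bool a)
| eq_tm_sub_if : forall a (G H : ctx a) A Mt Mf N d,
    wf_sub G d H ->
    wf_ty (cx_ext (hid a) H (ty_bool a)) Large A ->
    wf_tm H Mt (ty_sub A (sb_inst (hid a) (tm_true a))) ->
    wf_tm H Mf (ty_sub A (sb_inst (hid a) (tm_false a))) ->
    wf_tm H N (ty_bool a) ->
    eq_tm G (tm_sub (tm_if A Mt Mf N) d)
      (tm_if (ty_sub A (sb_lift (hid a) d)) (tm_sub Mt d) (tm_sub Mf d) (tm_sub N d))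
      (ty_sub (ty_sub A (sb_inst (hid a) N)) d)
| eq_tm_sub_pair : forall a (G H : ctx a) A B M N d,
    wf_sub G d H ->
    wf_ty (cx_ext (hid a) H A) Large B ->
    wf_tm H M A -> wf_tm H N (ty_sub B (sb_inst (hid a) M)) ->
    eq_tm G (tm_sub (tm_pair M N) d) (tm_pair (tm_sub M d) (tm_sub N d))
      (ty_sub (ty_sigma A B) d)
| eq_tm_sub_fst : forall a (G H : ctx a) A B M d,
    wf_sub G d H -> wf_tm H M (ty_sigma A B) ->
    eq_tm G (tm_sub (tm_fst M) d) (tm_fst (tm_sub M d)) (ty_sub A d)
| eq_tm_sub_snd : forall a (G H : ctx a) A B M d,
    wf_sub G d H -> wf_tm H M (ty_sigma A B) ->
    eq_tm G (tm_sub (tm_snd M) d) (tm_snd (tm_sub M d))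
      (ty_sub (ty_sub B (sb_inst (hid a) (tm_fst M))) d)
| eq_tm_sub_lam : forall a b (u : hom a b) (G H : ctx b) A B M d,
    wf_sub G d H -> wf_ty (cx_lock u H) Large A -> wf_tm (cx_ext u H A) M B ->
    eq_tm G (tm_sub (tm_lam u M) d) (tm_lam u (tm_sub M (sb_lift u d)))
      (ty_sub (ty_pi u A B) d)
| eq_tm_sub_app : forall a b (u : hom a b) (G H : ctx b) A B M N d,
    wf_sub G d H -> wf_tm H M (ty_pi u A B) -> wf_tm (cx_lock u H) N A ->
    eq_tm G (tm_sub (tm_app u M N) d)
      (tm_app u (tm_sub M d) (tm_sub N (sb_lock u d)))
      (ty_sub (ty_sub B (sb_inst u N)) d)
| eq_tm_sub_refl : forall a (G H : ctx a) A M d,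
    wf_sub G d H -> wf_tm H M A ->
    eq_tm G (tm_sub (tm_refl M) d) (tm_refl (tm_sub M d)) (ty_sub (ty_id A M M) d)
| eq_tm_sub_J : forall a (G H : ctx a) A B M N0 N1 P d,
    wf_sub G d H ->
    wf_ty (cx_J H A) Large B ->
    wf_tm (cx_ext (hid a) H A) M
      (ty_sub B (sb_J (sb_wk a) (tm_var a) (tm_var a) (tm_refl (tm_var a)))) ->
    wf_tm H N0 A -> wf_tm H N1 A -> wf_tm H P (ty_id A N0 N1) ->
    eq_tm G (tm_sub (tm_J B M P) d)
      (tm_J (ty_sub B (sb_lift (hid a) (sb_lift (hid a) (sb_lift (hid a) d))))
            (tm_sub M (sb_lift (hid a) d)) (tm_sub P d))
      (ty_sub (ty_sub B (sb_J (sb_id a) N0 N1 P)) d)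
| eq_tm_sub_mod : forall a b (u : hom a b) (G H : ctx b) A M d,
    wf_sub G d H -> wf_tm (cx_lock u H) M A ->
    eq_tm G (tm_sub (tm_mod u M) d) (tm_mod u (tm_sub M (sb_lock u d)))
      (ty_sub (ty_mod u A) d)
| eq_tm_sub_let : forall a b c (v : hom b c) (u : hom a b) (G H : ctx c) A B M0 M1 d,
    wf_sub G d H ->
    wf_ty (cx_ext v H (ty_mod u A)) Large B ->
    wf_tm (cx_lock v H) M0 (ty_mod u A) ->
    wf_tm (cx_ext (hcomp v u) H A) M1
      (ty_sub B (sb_ext v (sb_wk c) (tm_mod u (tm_var a)))) ->
    eq_tm G (tm_sub (tm_let v u B M0 M1) d)
      (tm_let v u (ty_sub B (sb_lift v d)) (tm_sub M0 (sb_lock v d))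
              (tm_sub M1 (sb_lift (hcomp v u) d)))
      (ty_sub (ty_sub B (sb_inst v M0)) d)
| eq_tm_sub_code : forall a (G H : ctx a) A d,
    wf_sub G d H -> wf_ty H Small A ->
    eq_tm G (tm_sub (tm_code A) d) (tm_code (ty_sub A d)) (ty_univ a)

with wf_sub (T : mode_theory) : forall a : mode T, ctx a -> sub a -> ctx a -> Prop :=
| wf_sb_conv : forall a (G G' H H' : ctx a) d,
    eq_ctx G G' -> eq_ctx H H' -> wf_sub G d H -> wf_sub G' d H'
| wf_sb_emp : forall a (G : ctx a), wf_ctx G -> wf_sub G (sb_emp a) (cx_emp a)
| wf_sb_id : forall a (G : ctx a), wf_ctx G -> wf_sub G (sb_id a) G
| wf_sb_comp : forall a (G H K : ctx a) d e,
    wf_sub G e H -> wf_sub H d K -> wf_sub G (sb_comp d e) K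
| wf_sb_wk : forall a b (u : hom a b) (G : ctx b) A,
    wf_ctx G -> wf_ty (cx_lock u G) Large A -> wf_sub (cx_ext u G A) (sb_wk b) G
| wf_sb_ext : forall a b (u : hom a b) (G H : ctx b) A d M,
    wf_sub G d H -> wf_ty (cx_lock u H) Large A ->
    wf_tm (cx_lock u G) M (ty_sub A (sb_lock u d)) ->
    wf_sub G (sb_ext u d M) (cx_ext u H A)
| wf_sb_lock : forall a b (u : hom a b) (G H : ctx b) d,
    wf_sub G d H -> wf_sub (cx_lock u G) (sb_lock u d) (cx_lock u H)
| wf_sb_key : forall a b (u v : hom a b) (x : cell u v) (G : ctx b),
    wf_ctx G -> wf_sub (cx_lock v G) (sb_key x G) (cx_lock u G)

with eq_sub (T : mode_theory) :
    forall a : mode T, ctx a -> sub a -> sub a -> ctx a -> Prop :=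
| eq_sb_refl : forall a (G H : ctx a) d, wf_sub G d H -> eq_sub G d d H
| eq_sb_sym : forall a (G H : ctx a) d e, eq_sub G d e H -> eq_sub G e d H
| eq_sb_trans : forall a (G H : ctx a) d e f,
    eq_sub G d e H -> eq_sub G e f H -> eq_sub G d f H
| eq_sb_conv : forall a (G G' H H' : ctx a) d e,
    eq_ctx G G' -> eq_ctx H H' -> eq_sub G d e H -> eq_sub G' d e H'
| eq_sb_comp : forall a (G H K : ctx a) d d' e e',
    eq_sub G e e' H -> eq_sub H d d' K -> eq_sub G (sb_comp d e) (sb_comp d' e') K
| eq_sb_ext : forall a b (u : hom a b) (G H : ctx b) A d d' M M',
    eq_sub G d d' H -> wf_ty (cx_lock u H) Large A ->
    eq_tm (cx_lock u G) M M' (ty_sub A (sb_lock u d)) ->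
    eq_sub G (sb_ext u d M) (sb_ext u d' M') (cx_ext u H A)
| eq_sb_lock : forall a b (u : hom a b) (G H : ctx b) d e,
    eq_sub G d e H -> eq_sub (cx_lock u G) (sb_lock u d) (sb_lock u e) (cx_lock u H)
| eq_sb_key : forall a b (u v : hom a b) (x y : cell u v) (G H : ctx b),
    cell_eq x y -> eq_ctx G H ->
    eq_sub (cx_lock v G) (sb_key x G) (sb_key y H) (cx_lock u G)
| eq_sb_id_l : forall a (G H : ctx a) d,
    wf_sub G d H -> eq_sub G (sb_comp (sb_id a) d) d H
| eq_sb_id_r : forall a (G H : ctx a) d,
    wf_sub G d H -> eq_sub G (sb_comp d (sb_id a)) d H
| eq_sb_assoc : forall a (G H K L : ctx a) d e f,
    wf_sub G f H -> wf_sub H e K -> wf_sub K d L ->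
    eq_sub G (sb_comp d (sb_comp e f)) (sb_comp (sb_comp d e) f) L
| eq_sb_emp_eta : forall a (G : ctx a) d,
    wf_sub G d (cx_emp a) -> eq_sub G d (sb_emp a) (cx_emp a)
| eq_sb_wk_ext : forall a b (u : hom a b) (G H : ctx b) A d M,
    wf_sub G d H -> wf_ty (cx_lock u H) Large A ->
    wf_tm (cx_lock u G) M (ty_sub A (sb_lock u d)) ->
    eq_sub G (sb_comp (sb_wk b) (sb_ext u d M)) d H
| eq_sb_ext_eta : forall a b (u : hom a b) (G H : ctx b) A d,
    wf_sub G d (cx_ext u H A) ->
    eq_sub G d
      (sb_ext u (sb_comp (sb_wk b) d) (tm_sub (tm_var a) (sb_lock u d)))
      (cx_ext u H A)
| eq_sb_lock_sb_id : forall a b (u : hom a b) (G : ctx b),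
    wf_ctx G -> eq_sub (cx_lock u G) (sb_lock u (sb_id b)) (sb_id a) (cx_lock u G)
| eq_sb_lock_sb_comp : forall a b (u : hom a b) (G H K : ctx b) d e,
    wf_sub G e H -> wf_sub H d K ->
    eq_sub (cx_lock u G) (sb_lock u (sb_comp d e))
      (sb_comp (sb_lock u d) (sb_lock u e)) (cx_lock u K)
| eq_sb_lock_hid : forall a (G H : ctx a) d,
    wf_sub G d H -> eq_sub G (sb_lock (hid a) d) d H
| eq_sb_lock_hcomp : forall a b c (u : hom b c) (v : hom a b) (G H : ctx c) d,
    wf_sub G d H ->
    eq_sub (cx_lock (hcomp u v) G) (sb_lock v (sb_lock u d))
      (sb_lock (hcomp u v) d) (cx_lock (hcomp u v) H)
| eq_sb_key_nat : forall a b (u v : hom a b) (x : cell u v) (G H : ctx b) d,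
    wf_sub G d H ->
    eq_sub (cx_lock v G) (sb_comp (sb_key x H) (sb_lock v d))
      (sb_comp (sb_lock u d) (sb_key x G)) (cx_lock u H)
| eq_sb_key_id : forall a b (u : hom a b) (G : ctx b),
    wf_ctx G -> eq_sub (cx_lock u G) (sb_key (idcell u) G) (sb_id a) (cx_lock u G)
| eq_sb_key_vcell : forall a b (u v w : hom a b)
      (y : cell v w) (x : cell u v) (G : ctx b),
    wf_ctx G ->
    eq_sub (cx_lock w G) (sb_key (vcell y x) G)
      (sb_comp (sb_key x G) (sb_key y G)) (cx_lock u G)
| eq_sb_key_hcell : forall a b c (u u' : hom b c) (v v' : hom a b)
      (y : cell u u') (x : cell v v') (G : ctx c),
    wf_ctx G ->
    eq_sub (cx_lock (hcomp u' v') G) (sb_key (hcell y x) G)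
      (sb_comp (sb_key x (cx_lock u G)) (sb_lock v' (sb_key y G)))
      (cx_lock (hcomp u v) G).

Definition ty_arrow {T : mode_theory} {a : mode T} (X Y : ty a) : ty a :=
  ty_pi (hid a) X (ty_sub Y (sb_wk a)).

(** [(x : X) -> Id X (g (f x)) x] *)
Definition ty_section {T : mode_theory} {a : mode T} (X : ty a) (f g : tm a) : ty a :=
  let w := sb_wk a in
  let x := tm_var a in
  ty_pi (hid a) X
    (ty_id (ty_sub X w)
       (tm_app (hid a) (tm_sub g w) (tm_app (hid a) (tm_sub f w) x))
       x).

Definition ty_equiv {T : mode_theory} {a : mode T} (G : ctx a) (X Y : ty a) : Prop :=
  wf_ty G Large X /\ wf_ty G Large Y /\
  exists f g h k : tm a,
    wf_tm G f (ty_arrow X Y) /\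
    wf_tm G g (ty_arrow Y X) /\
    wf_tm G h (ty_section X f g) /\
    wf_tm G k (ty_section Y g f).

(* Main.v *)
(** As [nu] is left adjoint to [mu], a boolean [y] under [nu] can be eliminated into any
    type [C] by eliminating [y] at mode [m] into [<mu | C>] and then unpacking the result
    with the counit [eps].  With [C = Bool] this gives [<nu | Bool> -> Bool]; the map back
    is a case distinction.  The composite on [Bool] is the identity by cases.  For the
    composite on [<nu | Bool>], eliminate [y] into [<mu | C(y)>], where [C(y)] says that
    the composite fixes [mod_nu(y)]: to be stated under the locks [mu] and [nu], [C] has
    to use [y] along the unit [eta], and the triangle identity at [nu] cancels this
    [eta] against the [eps] of the unpacking. *)

Require Import Defs.

Set Implicit Arguments.
Unset Strict Implicit.
Unset Printing Implicit Defensive.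

Create HintDb mtt.
#[local] Hint Resolve wf_cx_emp wf_cx_lock wf_sb_emp wf_sb_id wf_sb_lock
  wf_sb_key eq_cx_refl eq_ty_refl eq_tm_refl eq_sb_refl wf_tm_true wf_tm_false
  wf_sb_comp : mtt.

(** * Conversion in a fixed context, and maps to the empty context *)

Lemma wf_tm_ty (T : mode_theory) (a : mode T) (G : ctx a) M A B :
  wf_ctx G -> eq_ty G Large A B -> wf_tm G M A -> wf_tm G M B.
Proof. intros; eapply wf_tm_conv; eauto with mtt. Qed.

Lemma eq_tm_ty (T : mode_theory) (a : mode T) (G : ctx a) M N A B :
  wf_ctx G -> eq_ty G Large A B -> eq_tm G M N A -> eq_tm G M N B.
Proof. intros; eapply eq_tm_conv; eauto with mtt. Qed.

Lemma eq_sub_emp (T : mode_theory) (a : mode T) (G : ctx a) d e :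
  wf_sub G d (cx_emp a) -> wf_sub G e (cx_emp a) -> eq_sub G d e (cx_emp a).
Proof.
  intros; eapply eq_sb_trans; [now apply eq_sb_emp_eta|].
  now apply eq_sb_sym, eq_sb_emp_eta.
Qed.

(** * Types stable under substitution *)

(** A semantic stand-in for closed types. Explicit substitutions force a type conversion at almost
    every rule; for rigid types these conversions are discharged once and for all, and such a type
    can serve unweakened as a constant motive. *)
Definition rigid (T : mode_theory) (a : mode T) (A : ty a) : Prop :=
  (forall G, wf_ctx G -> wf_ty G Large A) /\
  (forall G H d, wf_sub G d H -> wf_ctx G -> wf_ctx H ->
    eq_ty G Large (ty_sub A d) A).

Lemma rigid_wf (T : mode_theory) (a : mode T) (A : ty a) G :
  rigid A -> wf_ctx G -> wf_ty G Large A.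
Proof. intros [h _]; auto. Qed.

Lemma rigid_sub (T : mode_theory) (a : mode T) (A : ty a) G d H :
  rigid A -> wf_sub G d H -> wf_ctx G -> wf_ctx H -> eq_ty G Large (ty_sub A d) A.
Proof. intros [_ h]; intros; eapply h; eauto. Qed.

Lemma rigid_bool (T : mode_theory) (a : mode T) : rigid (ty_bool a).
Proof.
  split; intros.
  - now apply wf_ty_cum, wf_ty_bool.
  - eapply eq_ty_cum, eq_ty_sub_bool; eauto.
Qed.

Lemma wf_cx_rext (T : mode_theory) (a b : mode T) (u : hom a b) (A : ty a) G :
  rigid A -> wf_ctx G -> wf_ctx (cx_ext u G A).
Proof. intros; apply wf_cx_ext; [|apply rigid_wf]; auto with mtt. Qed.

#[local] Hint Resolve rigid_wf rigid_bool wf_cx_rext wf_sb_wk : mtt.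

(** A substitution [d] acts on [A] below the modality as [sb_lock u d], to which rigidity of [A]
    applies in the locked contexts. *)
Lemma rigid_mod (T : mode_theory) (a b : mode T) (u : hom a b) (A : ty a) :
  rigid A -> rigid (ty_mod u A).
Proof.
  intros hA; split; intros.
  - apply wf_ty_mod; auto with mtt.
  - eapply eq_ty_trans; [eapply eq_ty_sub_mod; eauto with mtt|].
    apply eq_ty_mod; auto.
    eapply rigid_sub; [|apply wf_sb_lock|..]; eauto with mtt.
Qed.
#[local] Hint Resolve rigid_mod : mtt.

Lemma wf_tm_rsub (T : mode_theory) (a : mode T) (A : ty a) (G H : ctx a) d M :
  rigid A -> wf_sub G d H -> wf_ctx G -> wf_ctx H -> wf_tm H M A ->
  wf_tm G (tm_sub M d) A.
Proof.
  intros; eapply wf_tm_ty; [auto|eapply rigid_sub|eapply wf_tm_sub]; eauto.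
Qed.

Lemma eq_tm_rsub (T : mode_theory) (a : mode T) (A : ty a) (G H : ctx a) d e M N :
  rigid A -> wf_sub G d H -> wf_ctx G -> wf_ctx H ->
  eq_sub G d e H -> eq_tm H M N A -> eq_tm G (tm_sub M d) (tm_sub N e) A.
Proof.
  intros hA hd hG hH; intros; eapply eq_tm_ty; [auto|eapply (rigid_sub hA hd hG hH)|].
  eapply eq_tm_sub; eauto.
Qed.

Lemma eq_tm_rsub_comp (T : mode_theory) (a : mode T) (A : ty a) (G H K : ctx a) d e M :
  rigid A -> wf_sub G e H -> wf_sub H d K -> wf_tm K M A ->
  wf_ctx G -> wf_ctx H -> wf_ctx K ->
  eq_tm G (tm_sub (tm_sub M d) e) (tm_sub M (sb_comp d e)) A.
Proof.
  intros hA he hd hM hG hH hK; eapply eq_tm_ty; [auto| |eapply eq_tm_sub_comp; eauto].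
  eapply rigid_sub; eauto with mtt.
Qed.

(** [cx_lock (hid a) G] and [G] are different raw contexts, related only by [eq_ctx]. Variables and
    arguments under the identity modality are typed below the identity lock, so this lemma and the
    next three provide the passage in both directions. *)
Lemma wf_tm_rlock_id (T : mode_theory) (a : mode T) (A : ty a) (G : ctx a) M :
  rigid A -> wf_ctx G -> wf_tm G M A -> wf_tm (cx_lock (hid a) G) M A.
Proof.
  intros; eapply wf_tm_conv; [apply eq_cx_sym, eq_cx_lock_id; auto|apply eq_ty_refl|];
    eauto with mtt.
Qed.

Lemma eq_tm_rlock_id (T : mode_theory) (a : mode T) (A : ty a) (G : ctx a) M N :
  rigid A -> wf_ctx G -> eq_tm G M N A -> eq_tm (cx_lock (hid a) G) M N A.
Proof.
  intros; eapply eq_tm_conv; [apply eq_cx_sym, eq_cx_lock_id; auto|apply eq_ty_refl|];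
    eauto with mtt.
Qed.

Lemma wf_tm_runlock_id (T : mode_theory) (a : mode T) (A : ty a) (G : ctx a) M :
  rigid A -> wf_ctx G -> wf_tm (cx_lock (hid a) G) M A -> wf_tm G M A.
Proof.
  intros; eapply wf_tm_conv; [apply eq_cx_lock_id; auto|apply eq_ty_refl|]; eauto with mtt.
Qed.

Lemma eq_tm_runlock_id (T : mode_theory) (a : mode T) (A : ty a) (G : ctx a) M N :
  rigid A -> wf_ctx G -> eq_tm (cx_lock (hid a) G) M N A -> eq_tm G M N A.
Proof.
  intros; eapply eq_tm_conv; [apply eq_cx_lock_id; auto|apply eq_ty_refl|]; eauto with mtt.
Qed.

#[local] Hint Resolve wf_tm_rlock_id : mtt.

Lemma wf_tm_rvar (T : mode_theory) (a b : mode T) (u : hom a b) (A : ty a) G :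
  rigid A -> wf_ctx G -> wf_tm (cx_lock u (cx_ext u G A)) (tm_var a) A.
Proof.
  intros; eapply wf_tm_ty; [|eapply rigid_sub|apply wf_tm_var];
    try apply wf_sb_lock, wf_sb_wk; auto with mtt.
Qed.

Lemma wf_tm_rvar_id (T : mode_theory) (a : mode T) (A : ty a) G :
  rigid A -> wf_ctx G -> wf_tm (cx_ext (hid a) G A) (tm_var a) A.
Proof. intros; apply wf_tm_runlock_id; auto using wf_tm_rvar with mtt. Qed.
#[local] Hint Resolve wf_tm_rvar wf_tm_rvar_id : mtt.

Lemma wf_tm_rty_sub (T : mode_theory) (a : mode T) (A : ty a) (G H : ctx a) d M :
  rigid A -> wf_sub G d H -> wf_ctx G -> wf_ctx H -> wf_tm G M A ->
  wf_tm G M (ty_sub A d).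
Proof.
  intros; eapply wf_tm_ty; [auto|apply eq_ty_sym; eapply rigid_sub|]; eauto.
Qed.

Lemma eq_tm_rty_sub (T : mode_theory) (a : mode T) (A : ty a) (G H : ctx a) d M N :
  rigid A -> wf_sub G d H -> wf_ctx G -> wf_ctx H -> eq_tm G M N A ->
  eq_tm G M N (ty_sub A d).
Proof.
  intros; eapply eq_tm_ty; [auto|apply eq_ty_sym; eapply rigid_sub|]; eauto.
Qed.

Lemma wf_sub_rext (T : mode_theory) (a b : mode T) (u : hom a b) (A : ty a) G H d M :
  rigid A -> wf_sub G d H -> wf_ctx G -> wf_ctx H -> wf_tm (cx_lock u G) M A ->
  wf_sub G (sb_ext u d M) (cx_ext u H A).
Proof.
  intros; apply wf_sb_ext; auto with mtt.
  eapply wf_tm_rty_sub; [|apply wf_sb_lock|..]; eauto with mtt.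
Qed.
#[local] Hint Resolve wf_sub_rext : mtt.

Lemma eq_sub_rext (T : mode_theory) (a b : mode T) (u : hom a b) (A : ty a) G H d e M N :
  rigid A -> wf_sub G d H -> wf_ctx G -> wf_ctx H -> eq_sub G d e H ->
  eq_tm (cx_lock u G) M N A ->
  eq_sub G (sb_ext u d M) (sb_ext u e N) (cx_ext u H A).
Proof.
  intros; apply eq_sb_ext; auto with mtt.
  eapply eq_tm_rty_sub; [|apply wf_sb_lock|..]; eauto with mtt.
Qed.

Lemma eq_sub_rwk_ext (T : mode_theory) (a b : mode T) (u : hom a b) (A : ty a) G H d M :
  rigid A -> wf_sub G d H -> wf_ctx G -> wf_ctx H -> wf_tm (cx_lock u G) M A ->
  eq_sub G (sb_comp (sb_wk b) (sb_ext u d M)) d H.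
Proof.
  intros; eapply eq_sb_wk_ext; eauto with mtt.
  eapply wf_tm_rty_sub; [|apply wf_sb_lock|..]; eauto with mtt.
Qed.

Lemma eq_tm_rvar_ext (T : mode_theory) (a b : mode T) (u : hom a b) (A : ty a) G H d M :
  rigid A -> wf_sub G d H -> wf_ctx G -> wf_ctx H -> wf_tm (cx_lock u G) M A ->
  eq_tm (cx_lock u G) (tm_sub (tm_var a) (sb_lock u (sb_ext u d M))) M A.
Proof.
  intros hA hd hG hH hM.
  assert (hd' := wf_sb_lock u hd).
  eapply eq_tm_ty; [auto with mtt| |eapply eq_tm_var_ext; eauto with mtt].
  - eapply rigid_sub; eauto with mtt.
  - eapply wf_tm_rty_sub; eauto with mtt.
Qed.

(** The computation rule for variables speaks only of substitutions of the form [sb_lock u _];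
    [eq_sb_lock_hid] puts an unlocked substitution into that form. *)
Lemma eq_tm_rvar_ext_id (T : mode_theory) (a : mode T) (A : ty a) (G H : ctx a) d M :
  rigid A -> wf_sub G d H -> wf_ctx G -> wf_ctx H -> wf_tm G M A ->
  eq_tm G (tm_sub (tm_var a) (sb_ext (hid a) d M)) M A.
Proof.
  intros hA hd hG hH hM.
  assert (hs : wf_sub G (sb_ext (hid a) d M) (cx_ext (hid a) H A)) by auto with mtt.
  eapply eq_tm_trans.
  - eapply eq_tm_rsub; [auto|exact hs|auto|auto with mtt| |auto with mtt].
    apply eq_sb_sym, eq_sb_lock_hid, hs.
  - apply eq_tm_runlock_id; auto.
    eapply (eq_tm_rvar_ext hA hd); auto with mtt.
Qed.

(** Eta for extended substitutions splits the composite into its weakening and its last variable;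
    associativity and the two computation rules for extensions then evaluate each part. *)
Lemma eq_sub_rext_comp (T : mode_theory) (a b : mode T) (u : hom a b) (A : ty a)
    G H K d e M :
  rigid A -> wf_sub G e H -> wf_sub H d K -> wf_tm (cx_lock u H) M A ->
  wf_ctx G -> wf_ctx H -> wf_ctx K ->
  eq_sub G (sb_comp (sb_ext u d M) e)
    (sb_ext u (sb_comp d e) (tm_sub M (sb_lock u e))) (cx_ext u K A).
Proof.
  intros hA he hd hM hG hH hK.
  assert (hs : wf_sub H (sb_ext u d M) (cx_ext u K A)) by auto with mtt.
  assert (hse := wf_sb_comp he hs).
  assert (hw : wf_sub (cx_ext u K A) (sb_wk b) K) by auto with mtt.
  assert (hG' : wf_ctx (cx_lock u G)) by auto with mtt.
  assert (hH' : wf_ctx (cx_lock u H)) by auto with mtt.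
  assert (hK' : wf_ctx (cx_ext u K A)) by auto with mtt.
  eapply eq_sb_trans; [eapply eq_sb_ext_eta, hse|].
  apply eq_sub_rext; auto.
  - eauto with mtt.
  - eapply eq_sb_trans; [eapply eq_sb_assoc; eauto|].
    eapply eq_sb_comp; eauto with mtt.
    eapply eq_sub_rwk_ext; eauto.
  - assert (hv : wf_tm (cx_lock u (cx_ext u K A)) (tm_var a) A) by auto with mtt.
    eapply eq_tm_trans.
    + eapply eq_tm_rsub; [auto|apply wf_sb_lock, hse| | |
        eapply eq_sb_lock_sb_comp; eauto|apply eq_tm_refl, hv]; auto with mtt.
    + eapply eq_tm_trans.
      * apply eq_tm_sym; eapply eq_tm_rsub_comp;
          [auto|apply wf_sb_lock, he|apply wf_sb_lock, hs|auto| | |]; auto with mtt.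
      * eapply eq_tm_rsub; [auto|apply wf_sb_lock, he|auto|auto|eauto with mtt|].
        eapply eq_tm_rvar_ext; eauto.
Qed.

Lemma wf_sub_rlift (T : mode_theory) (a b : mode T) (u : hom a b) (A : ty a) G H d :
  rigid A -> wf_sub G d H -> wf_ctx G -> wf_ctx H ->
  wf_sub (cx_ext u G A) (sb_lift u d) (cx_ext u H A).
Proof. intros; apply wf_sub_rext; eauto with mtt. Qed.

Lemma wf_sub_rinst (T : mode_theory) (a b : mode T) (u : hom a b) (A : ty a) G M :
  rigid A -> wf_ctx G -> wf_tm (cx_lock u G) M A ->
  wf_sub G (sb_inst u M) (cx_ext u G A).
Proof. intros; apply wf_sub_rext; eauto with mtt. Qed.
#[local] Hint Resolve wf_sub_rlift wf_sub_rinst : mtt.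

(** The map into a one-variable context that forgets everything else. As [sb_emp] absorbs all
    substitutions, a further substitution changes only [M]. *)
Definition sb_point (T : mode_theory) (a b : mode T) (u : hom a b) (M : tm a) : sub b :=
  sb_ext u (sb_emp b) M.

Lemma wf_sub_point (T : mode_theory) (a b : mode T) (u : hom a b) (A : ty a) G M :
  rigid A -> wf_ctx G -> wf_tm (cx_lock u G) M A ->
  wf_sub G (sb_point u M) (cx_ext u (cx_emp b) A).
Proof. intros; apply wf_sub_rext; auto with mtt. Qed.
#[local] Hint Resolve wf_sub_point : mtt.

Lemma eq_sub_point (T : mode_theory) (a b : mode T) (u : hom a b) (A : ty a) G M N :
  rigid A -> wf_ctx G -> eq_tm (cx_lock u G) M N A ->
  eq_sub G (sb_point u M) (sb_point u N) (cx_ext u (cx_emp b) A).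
Proof. intros; apply eq_sub_rext; auto with mtt. Qed.

Lemma eq_sub_point_comp (T : mode_theory) (a b : mode T) (u : hom a b) (A : ty a)
    G H e M :
  rigid A -> wf_sub G e H -> wf_ctx G -> wf_ctx H -> wf_tm (cx_lock u H) M A ->
  eq_sub G (sb_comp (sb_point u M) e) (sb_point u (tm_sub M (sb_lock u e)))
    (cx_ext u (cx_emp b) A).
Proof.
  intros hA he hG hH hM.
  eapply eq_sb_trans; [eapply eq_sub_rext_comp; eauto with mtt|].
  assert (hc : wf_sub G (sb_comp (sb_emp b) e) (cx_emp b)) by eauto with mtt.
  assert (he' := wf_sb_lock u he).
  apply eq_sub_rext; auto with mtt.
  - apply eq_sub_emp; auto with mtt.
  - apply eq_tm_refl; eapply wf_tm_rsub; eauto with mtt.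
Qed.

(** * Boolean elimination with a constant motive *)

Lemma wf_tm_rif (T : mode_theory) (a : mode T) (C : ty a) G Mt Mf N :
  rigid C -> wf_ctx G -> wf_tm G Mt C -> wf_tm G Mf C -> wf_tm G N (ty_bool a) ->
  wf_tm G (tm_if C Mt Mf N) C.
Proof.
  intros.
  assert (hi : forall b, wf_tm G b (ty_bool a) ->
    wf_sub G (sb_inst (hid a) b) (cx_ext (hid a) G (ty_bool a))) by auto with mtt.
  eapply wf_tm_ty; [auto| |apply wf_tm_if; auto with mtt].
  - eapply rigid_sub; [|apply hi|..]; auto with mtt.
  - eapply wf_tm_rty_sub; [|apply hi|..]; auto with mtt.
  - eapply wf_tm_rty_sub; [|apply hi|..]; auto with mtt.
Qed.

Lemma eq_tm_rif (T : mode_theory) (a : mode T) (C : ty a) C' G Mt Mf N Mt' Mf' N' :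
  rigid C -> wf_ctx G -> eq_ty (cx_ext (hid a) G (ty_bool a)) Large C C' ->
  eq_tm G Mt Mt' C -> eq_tm G Mf Mf' C -> wf_tm G N (ty_bool a) ->
  eq_tm G N N' (ty_bool a) ->
  eq_tm G (tm_if C Mt Mf N) (tm_if C' Mt' Mf' N') C.
Proof.
  intros.
  assert (hi : forall b, wf_tm G b (ty_bool a) ->
    wf_sub G (sb_inst (hid a) b) (cx_ext (hid a) G (ty_bool a))) by auto with mtt.
  eapply eq_tm_ty; [auto| |apply eq_tm_if; auto with mtt].
  - eapply rigid_sub; [|apply hi|..]; auto with mtt.
  - eapply eq_tm_rty_sub; [|apply hi|..]; auto with mtt.
  - eapply eq_tm_rty_sub; [|apply hi|..]; auto with mtt.
Qed.

Lemma eq_tm_rif_true (T : mode_theory) (a : mode T) (C : ty a) G Mt Mf :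
  rigid C -> wf_ctx G -> wf_tm G Mt C -> wf_tm G Mf C ->
  eq_tm G (tm_if C Mt Mf (tm_true a)) Mt C.
Proof.
  intros.
  assert (hi : forall b, wf_tm G b (ty_bool a) ->
    wf_sub G (sb_inst (hid a) b) (cx_ext (hid a) G (ty_bool a))) by auto with mtt.
  eapply eq_tm_ty; [auto| |apply eq_tm_true_beta; auto with mtt].
  - eapply rigid_sub; [|apply hi|..]; auto with mtt.
  - eapply wf_tm_rty_sub; [|apply hi|..]; auto with mtt.
  - eapply wf_tm_rty_sub; [|apply hi|..]; auto with mtt.
Qed.

Lemma eq_tm_rif_false (T : mode_theory) (a : mode T) (C : ty a) G Mt Mf :
  rigid C -> wf_ctx G -> wf_tm G Mt C -> wf_tm G Mf C ->
  eq_tm G (tm_if C Mt Mf (tm_false a)) Mf C.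
Proof.
  intros.
  assert (hi : forall b, wf_tm G b (ty_bool a) ->
    wf_sub G (sb_inst (hid a) b) (cx_ext (hid a) G (ty_bool a))) by auto with mtt.
  eapply eq_tm_ty; [auto| |apply eq_tm_false_beta; auto with mtt].
  - eapply rigid_sub; [|apply hi|..]; auto with mtt.
  - eapply wf_tm_rty_sub; [|apply hi|..]; auto with mtt.
  - eapply wf_tm_rty_sub; [|apply hi|..]; auto with mtt.
Qed.

Lemma eq_tm_rif_sub (T : mode_theory) (a : mode T) (C : ty a) G H d Mt Mf N :
  rigid C -> wf_sub G d H -> wf_ctx G -> wf_ctx H ->
  wf_tm H Mt C -> wf_tm H Mf C -> wf_tm H N (ty_bool a) ->
  eq_tm G (tm_sub (tm_if C Mt Mf N) d)
    (tm_if C (tm_sub Mt d) (tm_sub Mf d) (tm_sub N d)) C.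
Proof.
  intros hC hd hG hH ht hf hN.
  assert (hi : forall b, wf_tm H b (ty_bool a) ->
    wf_sub H (sb_inst (hid a) b) (cx_ext (hid a) H (ty_bool a))) by auto with mtt.
  eapply eq_tm_trans.
  - eapply eq_tm_ty; [auto| |eapply eq_tm_sub_if; eauto with mtt].
    + eapply eq_ty_trans; [eapply eq_ty_sub_comp; eauto with mtt|].
      eapply rigid_sub; eauto with mtt.
    + eapply wf_tm_rty_sub; [|apply hi|..]; auto with mtt.
    + eapply wf_tm_rty_sub; [|apply hi|..]; auto with mtt.
  (* It remains to replace the substituted motive [ty_sub C (sb_lift (hid a) d)] by [C]; read
     backwards, the congruence is typed by the rigid motive. *)
  - apply eq_tm_sym; apply eq_tm_rif; auto with mtt;
      try (apply eq_tm_refl; eapply wf_tm_rsub; eauto with mtt).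
    + apply eq_ty_sym; eapply rigid_sub; [|apply wf_sub_rlift|..]; eauto with mtt.
    + eapply wf_tm_rsub; eauto with mtt.
Qed.

Lemma rigid_sub_inst (T : mode_theory) (a b : mode T) (u : hom a b) (A : ty a)
    (C : ty b) G M :
  wf_tm (cx_lock u G) M A -> rigid A -> rigid C -> wf_ctx G ->
  eq_ty G Large (ty_sub C (sb_inst u M)) C.
Proof. intros; eapply rigid_sub; [|eapply wf_sub_rinst|..]; eauto 8 with mtt. Qed.

(** * Modal elimination with a constant motive *)

Lemma wf_tm_rlock_comp (T : mode_theory) (a b c : mode T) (v : hom b c) (u : hom a b)
    (A : ty a) (G : ctx c) M :
  rigid A -> wf_ctx G -> wf_tm (cx_lock (hcomp v u) G) M A ->
  wf_tm (cx_lock u (cx_lock v G)) M A.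
Proof.
  intros; eapply wf_tm_conv;
    [apply eq_cx_sym, eq_cx_lock_comp; auto|apply eq_ty_refl|]; eauto 8 with mtt.
Qed.

Lemma wf_sub_rmod_ext (T : mode_theory) (a b c : mode T) (v : hom b c) (u : hom a b)
    (A : ty a) (G : ctx c) :
  rigid A -> wf_ctx G ->
  wf_sub (cx_ext (hcomp v u) G A) (sb_ext v (sb_wk c) (tm_mod u (tm_var a)))
    (cx_ext v G (ty_mod u A)).
Proof.
  intros; apply wf_sub_rext; auto 8 with mtt.
  apply wf_tm_mod; auto 8 with mtt.
  apply wf_tm_rlock_comp; auto 8 with mtt.
Qed.
#[local] Hint Resolve wf_sub_rmod_ext : mtt.

Lemma eq_tm_rsub_point_comp (T : mode_theory) (a b : mode T) (u : hom a b) (A : ty a)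
    (C : ty b) G H e M N :
  rigid A -> rigid C -> wf_sub G e H -> wf_ctx G -> wf_ctx H ->
  wf_tm (cx_lock u H) M A -> wf_tm (cx_ext u (cx_emp b) A) N C ->
  eq_tm G (tm_sub (tm_sub N (sb_point u M)) e)
    (tm_sub N (sb_point u (tm_sub M (sb_lock u e)))) C.
Proof.
  intros hA hC he hG hH hM hN.
  assert (hp : wf_sub H (sb_point u M) (cx_ext u (cx_emp b) A)) by auto 8 with mtt.
  assert (wf_ctx (cx_ext u (cx_emp b) A)) by auto 8 with mtt.
  eapply eq_tm_trans; [eapply eq_tm_rsub_comp; eauto|].
  eapply eq_tm_rsub; eauto 8 with mtt.
  eapply eq_sub_point_comp; eauto.
Qed.

(** [let_v mod_u(x) <- M in N] for a body [N] whose only variable is [x], so that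
    substitutions act on [M] alone. *)
Definition tm_clet (T : mode_theory) (a b c : mode T) (v : hom b c) (u : hom a b)
    (C : ty c) (M : tm b) (N : tm c) : tm c :=
  tm_let v u C M (tm_sub N (sb_point (hcomp v u) (tm_var a))).

Lemma wf_tm_clet (T : mode_theory) (a b c : mode T) (v : hom b c) (u : hom a b)
    (A : ty a) (C : ty c) G M N :
  rigid A -> rigid C -> wf_ctx G -> wf_tm (cx_lock v G) M (ty_mod u A) ->
  wf_tm (cx_ext (hcomp v u) (cx_emp c) A) N C ->
  wf_tm G (tm_clet v u C M N) C.
Proof.
  intros.
  eapply wf_tm_ty; [auto|eapply rigid_sub_inst|eapply wf_tm_let]; eauto 8 with mtt.
  eapply wf_tm_rty_sub; [|apply wf_sub_rmod_ext|..]; auto 8 with mtt.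
  eapply wf_tm_rsub; [|apply (wf_sub_point (A:=A))|..]; auto 8 with mtt.
Qed.

Lemma eq_tm_clet (T : mode_theory) (a b c : mode T) (v : hom b c) (u : hom a b)
    (A : ty a) (C : ty c) G M M' N :
  rigid A -> rigid C -> wf_ctx G ->
  wf_tm (cx_lock v G) M (ty_mod u A) ->
  eq_tm (cx_lock v G) M M' (ty_mod u A) ->
  wf_tm (cx_ext (hcomp v u) (cx_emp c) A) N C ->
  eq_tm G (tm_clet v u C M N) (tm_clet v u C M' N) C.
Proof.
  intros.
  eapply eq_tm_ty; [auto|eapply rigid_sub_inst|eapply eq_tm_let]; eauto 8 with mtt.
  eapply eq_tm_rty_sub; [|apply wf_sub_rmod_ext|..]; auto 8 with mtt.
  apply eq_tm_refl; eapply wf_tm_rsub; [|apply (wf_sub_point (A:=A))|..]; auto 8 with mtt.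
Qed.

Lemma eq_tm_clet_beta (T : mode_theory) (a b c : mode T) (v : hom b c) (u : hom a b)
    (A : ty a) (C : ty c) G M N :
  rigid A -> rigid C -> wf_ctx G -> wf_tm (cx_lock (hcomp v u) G) M A ->
  wf_tm (cx_ext (hcomp v u) (cx_emp c) A) N C ->
  eq_tm G (tm_clet v u C (tm_mod u M) N) (tm_sub N (sb_point (hcomp v u) M)) C.
Proof.
  intros hA hC hG hM hN.
  assert (hM' : wf_tm (cx_lock v G) (tm_mod u M) (ty_mod u A)).
  { apply wf_tm_mod; auto 8 with mtt; apply wf_tm_rlock_comp; auto. }
  eapply eq_tm_trans.
  - eapply eq_tm_ty; [auto|eapply rigid_sub_inst|eapply eq_tm_let_beta];
      eauto 8 with mtt.
    eapply wf_tm_rty_sub; [|apply wf_sub_rmod_ext|..]; auto 8 with mtt.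
    eapply wf_tm_rsub; [|apply (wf_sub_point (A:=A))|..]; auto 8 with mtt.
  (* The rule leaves the point at the bound variable followed by [sb_inst]; together they are the
     point at [M]. *)
  - eapply eq_tm_trans; [eapply eq_tm_rsub_point_comp; eauto 8 with mtt|].
    eapply eq_tm_rsub; [|apply (wf_sub_point (A:=A))| | |
      apply (eq_sub_point (A:=A))|]; eauto 8 with mtt.
    + eapply wf_tm_rsub; [|eapply wf_sb_lock, wf_sub_rinst|..]; eauto 8 with mtt.
    + eapply eq_tm_rvar_ext; eauto 8 with mtt.
Qed.

Lemma eq_tm_clet_sub (T : mode_theory) (a b c : mode T) (v : hom b c) (u : hom a b)
    (A : ty a) (C : ty c) G H d M N :
  rigid A -> rigid C -> wf_sub G d H -> wf_ctx G -> wf_ctx H ->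
  wf_tm (cx_lock v H) M (ty_mod u A) ->
  wf_tm (cx_ext (hcomp v u) (cx_emp c) A) N C ->
  eq_tm G (tm_sub (tm_clet v u C M N) d) (tm_clet v u C (tm_sub M (sb_lock v d)) N) C.
Proof.
  intros hA hC hd hG hH hM hN.
  assert (hd' := wf_sb_lock v hd).
  assert (hl : wf_sub (cx_ext (hcomp v u) G A) (sb_lift (hcomp v u) d)
    (cx_ext (hcomp v u) H A)) by auto 8 with mtt.
  assert (hMd : wf_tm (cx_lock v G) (tm_sub M (sb_lock v d)) (ty_mod u A)).
  { eapply wf_tm_rsub; eauto 8 with mtt. }
  eapply eq_tm_trans.
  - eapply eq_tm_ty; [auto| |eapply eq_tm_sub_let; eauto 8 with mtt].
    + eapply eq_ty_trans; [eapply eq_ty_sub_comp; eauto 8 with mtt|].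
      eapply rigid_sub; eauto 8 with mtt.
    + eapply wf_tm_rty_sub; [|apply wf_sub_rmod_ext|..]; auto 8 with mtt.
      eapply wf_tm_rsub; [|apply (wf_sub_point (A:=A))|..]; auto 8 with mtt.
  - apply eq_tm_sym.
    eapply eq_tm_ty; [auto|eapply rigid_sub_inst|eapply eq_tm_let]; eauto 8 with mtt.
    + apply eq_ty_sym; eapply rigid_sub; [|apply wf_sub_rlift|..]; eauto 8 with mtt.
    + eapply eq_tm_rty_sub; [|apply wf_sub_rmod_ext|..]; auto 8 with mtt.
      (* The point at the bound variable, followed by [sb_lift], is again the point at the bound
         variable, so the body is unchanged. *)
      apply eq_tm_sym.
      eapply eq_tm_trans; [eapply eq_tm_rsub_point_comp; eauto 8 with mtt|].
      eapply eq_tm_rsub; [|apply (wf_sub_point (A:=A))| | |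
      apply (eq_sub_point (A:=A))|]; eauto 8 with mtt.
      * eapply wf_tm_rsub; [|apply wf_sb_lock, hl|..]; eauto 8 with mtt.
      * eapply eq_tm_rvar_ext; eauto 8 with mtt.
Qed.

(** * Keys for the unit and the counit *)

(** Keys are contravariant in the 2-cell, so a cell into the identity gives a substitution out of
    [cx_lock (hid a) G], which is equal to [G]. *)
Lemma wf_sub_key_to_id (T : mode_theory) (a : mode T) (u : hom a a)
    (x : cell u (hid a)) (G : ctx a) :
  wf_ctx G -> wf_sub G (sb_key x G) (cx_lock u G).
Proof.
  intros; eapply wf_sb_conv; [apply eq_cx_lock_id| |apply wf_sb_key]; auto with mtt.
Qed.

Lemma eq_sub_key_to_id_nat (T : mode_theory) (a : mode T) (u : hom a a)
    (x : cell u (hid a)) (G H : ctx a) d :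
  wf_sub G d H -> wf_ctx G -> wf_ctx H ->
  eq_sub G (sb_comp (sb_key x H) d) (sb_comp (sb_lock u d) (sb_key x G)) (cx_lock u H).
Proof.
  intros hd hG hH; eapply eq_sb_trans.
  - eapply eq_sb_comp; [apply eq_sb_sym, eq_sb_lock_hid, hd|].
    apply eq_sb_refl, wf_sub_key_to_id; auto.
  - eapply eq_sb_conv; [apply eq_cx_lock_id| |apply eq_sb_key_nat]; auto with mtt.
Qed.

Definition eta : cell (hid m) (hcomp mu nu) := adj_eta.
Definition eps : cell (hcomp nu mu) (hid n) := adj_eps.

Lemma wf_sub_eta (G : ctx m) :
  wf_ctx G -> wf_sub (cx_lock nu (cx_lock mu G)) (sb_key eta G) G.
Proof.
  intros; eapply wf_sb_conv;
    [apply eq_cx_sym, eq_cx_lock_comp|apply eq_cx_lock_id|apply wf_sb_key]; auto.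
Qed.

Lemma wf_sub_eps (G : ctx n) :
  wf_ctx G -> wf_sub G (sb_key eps G) (cx_lock mu (cx_lock nu G)).
Proof.
  intros; eapply wf_sb_conv;
    [|apply eq_cx_sym, eq_cx_lock_comp|apply wf_sub_key_to_id]; auto with mtt.
Qed.
#[local] Hint Resolve wf_sub_key_to_id wf_sub_eta wf_sub_eps : mtt.

(** Naturality of keys concerns the single lock [hcomp mu nu] and an identity lock; the strict laws
    for locks carry it over to the iterated locks below which terms are formed. *)
Lemma eq_sub_eta_nat (G H : ctx m) d :
  wf_sub G d H -> wf_ctx G -> wf_ctx H ->
  eq_sub (cx_lock nu (cx_lock mu G))
    (sb_comp (sb_key eta H) (sb_lock nu (sb_lock mu d))) (sb_comp d (sb_key eta G)) H.
Proof.
  intros hd hG hH.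
  assert (hc : forall K : ctx m, wf_ctx K ->
    eq_ctx (cx_lock (hcomp mu nu) K) (cx_lock nu (cx_lock mu K)))
    by (intros; apply eq_cx_sym, eq_cx_lock_comp; auto).
  assert (hk : wf_sub (cx_lock (hcomp mu nu) H) (sb_key eta H) H).
  { eapply wf_sb_conv; [apply eq_cx_refl|apply eq_cx_lock_id|apply wf_sb_key];
      auto with mtt. }
  eapply eq_sb_conv; [apply hc, hG|apply eq_cx_refl, hH|].
  eapply eq_sb_trans.
  - eapply eq_sb_comp; [apply eq_sb_lock_hcomp, hd|apply eq_sb_refl, hk].
  - eapply eq_sb_trans.
    + eapply eq_sb_conv; [apply eq_cx_refl|apply eq_cx_lock_id, hH|apply eq_sb_key_nat, hd].
      auto with mtt.
    + eapply eq_sb_comp; [|apply eq_sb_lock_hid, hd].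
      apply eq_sb_refl; eapply wf_sb_conv;
        [apply eq_cx_refl|apply eq_cx_lock_id|apply wf_sb_key]; auto with mtt.
Qed.

(** This is the triangle identity at [nu], read through keys. A vertical composite of cells becomes
    a composite of keys in reverse order, and each whiskering by [idcell nu] leaves one nontrivial
    factor: the key of [eta] over the locked context, or the locked key of [eps]. *)
Lemma eq_sub_triangle (G : ctx n) :
  wf_ctx G ->
  eq_sub (cx_lock nu G)
    (sb_comp (sb_key eta (cx_lock nu G)) (sb_lock nu (sb_key eps G)))
    (sb_id m) (cx_lock nu G).
Proof.
  intros hG.
  assert (hnG : wf_ctx (cx_lock nu G)) by auto with mtt.
  (* [X] and [Y] are the two whiskered cells whose composite is [idcell nu] by [adj_triangle_nu]. *)
  pose (X := hcell (idcell nu) eta).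
  pose (Y := hcell eps (idcell nu)).
  assert (hk : wf_sub (cx_lock (hcomp mu nu) (cx_lock nu G))
    (sb_key eta (cx_lock nu G)) (cx_lock nu G)).
  { eapply wf_sb_conv; [apply eq_cx_refl|apply eq_cx_lock_id|apply wf_sb_key];
      auto with mtt. }
  assert (hX : eq_sub (cx_lock (hcomp mu nu) (cx_lock nu G)) (sb_key X G)
    (sb_key eta (cx_lock nu G)) (cx_lock nu G)).
  { eapply eq_sb_trans.
    - eapply eq_sb_conv; [apply eq_cx_sym, eq_cx_lock_comp, hG| |
        apply eq_sb_key_hcell, hG].
      apply eq_cx_refl; exact hnG.
    - eapply eq_sb_trans; [|apply eq_sb_id_r, hk].
      eapply eq_sb_comp; [|apply eq_sb_refl, hk].
      eapply eq_sb_trans; [|apply eq_sb_lock_sb_id, hnG].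
      apply eq_sb_lock, eq_sb_key_id, hG. }
  assert (he : eq_ctx (cx_lock (hcomp mu nu) (cx_lock nu G))
    (cx_lock nu (cx_lock (hcomp nu mu) G))).
  { eapply eq_cx_trans; [apply eq_cx_lock_comp, hG|].
    (* Both bracketings of [nu o mu o nu] compute to the same path, so the two context equations
       meet by conversion. *)
    apply eq_cx_sym; exact (eq_cx_lock_comp (hcomp nu mu) nu hG). }
  assert (hl : wf_sub (cx_lock nu G) (sb_lock nu (sb_key eps G))
    (cx_lock nu (cx_lock (hcomp nu mu) G))) by auto with mtt.
  assert (hY : eq_sub (cx_lock nu G) (sb_key Y G)
    (sb_lock nu (sb_key eps G)) (cx_lock (hcomp mu nu) (cx_lock nu G))).
  { eapply eq_sb_conv; [apply eq_cx_refl, hnG|apply eq_cx_sym, he|].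
    eapply eq_sb_trans; [|apply eq_sb_id_l, hl].
    eapply eq_sb_trans.
    - eapply eq_sb_conv; [|apply eq_cx_sym, eq_cx_lock_comp, hG|
        apply eq_sb_key_hcell, hG].
      apply eq_cx_refl; exact hnG.
    - eapply eq_sb_comp; [apply eq_sb_refl|apply eq_sb_key_id; auto with mtt].
      eapply wf_sb_conv; [apply eq_cx_refl, hnG| |exact hl].
      apply eq_cx_refl; auto with mtt. }
  assert (hT : cell_eq (vcell Y X) (idcell nu)) by exact adj_triangle_nu.
  eapply eq_sb_trans; [|apply eq_sb_key_id, hG].
  eapply eq_sb_trans; [|apply eq_sb_key; [apply hT|apply eq_cx_refl, hG]].
  apply eq_sb_sym; eapply eq_sb_trans; [apply eq_sb_key_vcell, hG|].
  eapply eq_sb_comp; [apply hY|apply hX].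
Qed.

(** * The two maps *)

Definition bool_nu : ty n := ty_mod nu (ty_bool m).

Lemma rigid_bool_nu : rigid bool_nu.
Proof. apply rigid_mod, rigid_bool. Qed.

#[local] Hint Resolve rigid_bool_nu : mtt.

(** Indexing the two constructors by a meta-level boolean lets each computation on them be stated
    once. *)
Definition tm_lit (T : mode_theory) (a : mode T) (b : bool) : tm a :=
  if b then tm_true a else tm_false a.

Lemma wf_tm_lit (T : mode_theory) (a : mode T) (b : bool) G :
  wf_ctx G -> wf_tm G (tm_lit a b) (ty_bool a).
Proof. destruct b; cbn; auto with mtt. Qed.

Lemma eq_tm_lit_sub (T : mode_theory) (a : mode T) (b : bool) G H d :
  wf_sub G d H -> eq_tm G (tm_sub (tm_lit a b) d) (tm_lit a b) (ty_bool a).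
Proof.
  destruct b; [apply eq_tm_sub_true|apply eq_tm_sub_false].
Qed.

Lemma wf_mod_lit (T : mode_theory) (a b : mode T) (u : hom a b) (c : bool) G :
  wf_ctx G -> wf_tm G (tm_mod u (tm_lit a c)) (ty_mod u (ty_bool a)).
Proof. intros; apply wf_tm_mod; auto using wf_tm_lit with mtt. Qed.
#[local] Hint Resolve wf_tm_lit wf_mod_lit : mtt.

Lemma eq_mod_lit_sub (T : mode_theory) (a b : mode T) (u : hom a b) (c : bool) G H d :
  wf_sub G d H -> wf_ctx G -> wf_ctx H ->
  eq_tm G (tm_sub (tm_mod u (tm_lit a c)) d) (tm_mod u (tm_lit a c))
    (ty_mod u (ty_bool a)).
Proof.
  intros hd hG hH.
  eapply eq_tm_trans.
  - eapply eq_tm_ty; [auto| |eapply eq_tm_sub_mod; eauto with mtt].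
    eapply rigid_sub; eauto with mtt.
  - apply eq_tm_mod; auto; eapply eq_tm_lit_sub, wf_sb_lock, hd.
Qed.

(** Used at both generators: at [nu] it is the map from [ty_bool n] to [bool_nu], and at [mu] it
    sends a boolean of mode [m] to [ty_mod mu (ty_bool n)]. *)
Definition mod_if (T : mode_theory) (a b : mode T) (u : hom a b) (t : tm b) : tm b :=
  tm_if (ty_mod u (ty_bool a)) (tm_mod u (tm_lit a true)) (tm_mod u (tm_lit a false)) t.

Lemma wf_mod_if (T : mode_theory) (a b : mode T) (u : hom a b) G t :
  wf_ctx G -> wf_tm G t (ty_bool b) -> wf_tm G (mod_if u t) (ty_mod u (ty_bool a)).
Proof. intros; apply wf_tm_rif; auto with mtt. Qed.
#[local] Hint Resolve wf_mod_if : mtt.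

Lemma eq_mod_if (T : mode_theory) (a b : mode T) (u : hom a b) G t t' :
  wf_ctx G -> wf_tm G t (ty_bool b) -> eq_tm G t t' (ty_bool b) ->
  eq_tm G (mod_if u t) (mod_if u t') (ty_mod u (ty_bool a)).
Proof. intros; apply eq_tm_rif; auto with mtt. Qed.

Lemma eq_mod_if_lit (T : mode_theory) (a b : mode T) (u : hom a b) (c : bool) G :
  wf_ctx G ->
  eq_tm G (mod_if u (tm_lit b c)) (tm_mod u (tm_lit a c)) (ty_mod u (ty_bool a)).
Proof.
  intros; destruct c; [apply eq_tm_rif_true|apply eq_tm_rif_false]; auto with mtt.
Qed.

Lemma eq_mod_if_sub (T : mode_theory) (a b : mode T) (u : hom a b) G H d t :
  wf_sub G d H -> wf_ctx G -> wf_ctx H -> wf_tm H t (ty_bool b) ->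
  eq_tm G (tm_sub (mod_if u t) d) (mod_if u (tm_sub t d)) (ty_mod u (ty_bool a)).
Proof.
  intros hd hG hH ht.
  eapply eq_tm_trans; [eapply eq_tm_rif_sub; eauto with mtt|].
  apply eq_tm_sym, eq_tm_rif; auto with mtt;
    try (apply eq_tm_sym; eapply eq_mod_lit_sub; eauto).
  - eapply wf_tm_rsub; eauto with mtt.
  - apply eq_tm_refl; eapply wf_tm_rsub; eauto with mtt.
Qed.

(** Keys record a raw context; taking [eps] over a fixed closed one makes this raw term
    independent of the ambient context. *)
Definition counit_bool : tm n :=
  tm_sub (tm_var n) (sb_key eps (cx_ext (hcomp nu mu) (cx_emp n) (ty_bool n))).

Lemma wf_counit_bool :
  wf_tm (cx_ext (hcomp nu mu) (cx_emp n) (ty_bool n)) counit_bool (ty_bool n).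
Proof.
  eapply wf_tm_rsub; [|apply wf_sub_key_to_id|..]; auto with mtt.
Qed.
#[local] Hint Resolve wf_counit_bool : mtt.

(** Naturality of [eps] exchanges the key with the point substitution. The variable then becomes the
    literal, which the remaining key fixes. *)
Lemma eq_counit_bool_lit (G : ctx n) (c : bool) :
  wf_ctx G ->
  eq_tm G (tm_sub counit_bool (sb_point (hcomp nu mu) (tm_lit n c))) (tm_lit n c)
    (ty_bool n).
Proof.
  intros hG.
  pose (Z := cx_ext (hcomp nu mu) (cx_emp n) (ty_bool n)).
  assert (hZ : wf_ctx Z) by (unfold Z; auto with mtt).
  assert (hp : wf_sub G (sb_point (hcomp nu mu) (tm_lit n c)) Z)
    by (unfold Z; auto with mtt).
  assert (hk := wf_sub_key_to_id eps hG).
  assert (hl := wf_sb_lock (hcomp nu mu) hp).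
  assert (hv : wf_tm (cx_lock (hcomp nu mu) Z) (tm_var n) (ty_bool n))
    by (unfold Z; auto with mtt).
  assert (hkZ := wf_sub_key_to_id eps hZ).
  eapply eq_tm_trans; [eapply eq_tm_rsub_comp; [|exact hp|exact hkZ|..]; auto with mtt|].
  eapply eq_tm_trans; [eapply eq_tm_rsub; [|exact (wf_sb_comp hp hkZ)| | |
    apply eq_sub_key_to_id_nat; [exact hp|..]|]; auto with mtt|].
  eapply eq_tm_trans;
    [apply eq_tm_sym; eapply eq_tm_rsub_comp; [|exact hk|exact hl|..]; auto with mtt|].
  eapply eq_tm_trans; [eapply eq_tm_rsub; [|exact hk|..]; auto with mtt
    |eapply eq_tm_lit_sub, hk].
  eapply eq_tm_rvar_ext; auto with mtt.
Qed.

(** The transpose of [mod_if mu] under the adjunction, applied to a boolean below the lock [nu]. *)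
Definition nu_elim_bool (t : tm m) : tm n :=
  tm_clet nu mu (ty_bool n) (mod_if mu t) counit_bool.

Lemma wf_nu_elim_bool (G : ctx n) t :
  wf_ctx G -> wf_tm (cx_lock nu G) t (ty_bool m) ->
  wf_tm G (nu_elim_bool t) (ty_bool n).
Proof. intros; eapply wf_tm_clet with (A := ty_bool n); auto with mtt. Qed.
#[local] Hint Resolve wf_nu_elim_bool : mtt.

Lemma eq_nu_elim_bool (G : ctx n) t t' :
  wf_ctx G -> wf_tm (cx_lock nu G) t (ty_bool m) ->
  eq_tm (cx_lock nu G) t t' (ty_bool m) ->
  eq_tm G (nu_elim_bool t) (nu_elim_bool t') (ty_bool n).
Proof.
  intros; eapply eq_tm_clet with (A := ty_bool n); auto with mtt.
  apply eq_mod_if; auto with mtt.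
Qed.

Lemma eq_nu_elim_bool_sub (G H : ctx n) d t :
  wf_sub G d H -> wf_ctx G -> wf_ctx H -> wf_tm (cx_lock nu H) t (ty_bool m) ->
  eq_tm G (tm_sub (nu_elim_bool t) d) (nu_elim_bool (tm_sub t (sb_lock nu d)))
    (ty_bool n).
Proof.
  intros hd hG hH ht.
  assert (hd' := wf_sb_lock nu hd).
  eapply eq_tm_trans.
  - eapply eq_tm_clet_sub with (A := ty_bool n); eauto with mtt.
  - eapply eq_tm_clet with (A := ty_bool n); auto with mtt.
    + eapply wf_tm_rsub; eauto with mtt.
    + eapply eq_mod_if_sub; eauto with mtt.
Qed.

Lemma eq_nu_elim_bool_lit (G : ctx n) (c : bool) :
  wf_ctx G -> eq_tm G (nu_elim_bool (tm_lit m c)) (tm_lit n c) (ty_bool n).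
Proof.
  intros hG.
  eapply eq_tm_trans.
  - eapply eq_tm_clet with (A := ty_bool n) (M' := tm_mod mu (tm_lit n c));
      auto using eq_mod_if_lit with mtt.
  - eapply eq_tm_trans; [apply eq_tm_clet_beta with (A := ty_bool n); auto with mtt|].
    apply eq_counit_bool_lit; auto.
Qed.

Definition from_nu (t : tm n) : tm n :=
  tm_clet (hid n) nu (ty_bool n) t (nu_elim_bool (tm_var m)).

Lemma wf_nu_elim_bool_var :
  wf_tm (cx_ext nu (cx_emp n) (ty_bool m)) (nu_elim_bool (tm_var m)) (ty_bool n).
Proof. apply wf_nu_elim_bool; auto with mtt. Qed.
#[local] Hint Resolve wf_nu_elim_bool_var : mtt.

Lemma wf_from_nu (G : ctx n) t :
  wf_ctx G -> wf_tm G t bool_nu -> wf_tm G (from_nu t) (ty_bool n).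
Proof.
  intros; eapply wf_tm_clet with (A := ty_bool m); auto with mtt.
Qed.

Lemma eq_from_nu (G : ctx n) t t' :
  wf_ctx G -> wf_tm G t bool_nu -> eq_tm G t t' bool_nu ->
  eq_tm G (from_nu t) (from_nu t') (ty_bool n).
Proof.
  intros; eapply eq_tm_clet with (A := ty_bool m); auto with mtt.
  eapply eq_tm_rlock_id; auto with mtt.
Qed.

Lemma eq_from_nu_sub (G H : ctx n) d t :
  wf_sub G d H -> wf_ctx G -> wf_ctx H -> wf_tm H t bool_nu ->
  eq_tm G (tm_sub (from_nu t) d) (from_nu (tm_sub t d)) (ty_bool n).
Proof.
  intros hd hG hH ht.
  assert (hd' := wf_sb_lock (hid n) hd).
  eapply eq_tm_trans.
  - eapply eq_tm_clet_sub with (A := ty_bool m); eauto with mtt.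
  - eapply eq_tm_clet with (A := ty_bool m); auto with mtt.
    + eapply wf_tm_rsub; eauto with mtt.
    + eapply eq_tm_rlock_id; auto with mtt.
      eapply eq_tm_rsub; [| | | |apply eq_sb_lock_hid, hd|]; auto with mtt.
      eapply wf_sb_conv; [apply eq_cx_lock_id|apply eq_cx_lock_id|exact hd']; auto.
Qed.

Lemma eq_from_nu_mod (G : ctx n) t :
  wf_ctx G -> wf_tm (cx_lock nu G) t (ty_bool m) ->
  eq_tm G (from_nu (tm_mod nu t)) (nu_elim_bool t) (ty_bool n).
Proof.
  intros hG ht.
  eapply eq_tm_trans; [apply eq_tm_clet_beta with (A := ty_bool m); auto with mtt|].
  (* Composition with the identity path computes, and this exposes the lock over which
     [nu_elim_bool] is formed. *)
  change (hcomp (hid n) nu) with nu.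
  eapply eq_tm_trans; [eapply eq_nu_elim_bool_sub; eauto with mtt|].
  assert (hl := wf_sb_lock nu (wf_sub_point (rigid_bool m) hG ht)).
  apply eq_nu_elim_bool; auto with mtt.
  - eapply wf_tm_rsub; eauto with mtt.
  - eapply eq_tm_rvar_ext; auto with mtt.
Qed.

(** * Operations on terms that commute with substitution *)

(** A map from [A] to [B] represented by a meta-level operation on raw terms, natural in the
    context. Composites and their computations are handled at this level, and abstraction by
    [tm_lam] happens only at the end. *)
Record natural (T : mode_theory) (a : mode T) (A B : ty a) (f : tm a -> tm a) : Prop := {
  natural_wf : forall G t, wf_ctx G -> wf_tm G t A -> wf_tm G (f t) B;
  natural_eq : forall G t t', wf_ctx G -> wf_tm G t A -> eq_tm G t t' A ->
    eq_tm G (f t) (f t') B;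
  natural_sub : forall G H d t, wf_sub G d H -> wf_ctx G -> wf_ctx H -> wf_tm H t A ->
    eq_tm G (tm_sub (f t) d) (f (tm_sub t d)) B }.

Lemma natural_mod_if (T : mode_theory) (a b : mode T) (u : hom a b) :
  natural (ty_bool b) (ty_mod u (ty_bool a)) (mod_if u).
Proof.
  split; intros; eauto using eq_mod_if, eq_mod_if_sub with mtt.
Qed.

Lemma natural_from_nu : natural bool_nu (ty_bool n) from_nu.
Proof.
  split; intros; eauto using wf_from_nu, eq_from_nu, eq_from_nu_sub with mtt.
Qed.

Lemma natural_comp (T : mode_theory) (a : mode T) (A B C : ty a) f g :
  rigid B -> natural A B f -> natural B C g -> natural A C (fun t => g (f t)).
Proof.
  intros hB [fw fe fs] [gw ge gs]; split; intros; auto.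
  eapply eq_tm_trans; [eapply gs; eauto|].
  apply ge; eauto.
  eapply wf_tm_rsub; eauto.
Qed.

(** The counterpart of the codomain of [ty_section] for a meta-level operation in place of two
    applied function terms; [wf_tm_section] passes from one to the other. *)
Definition ty_fixed (T : mode_theory) (a : mode T) (A : ty a) (f : tm a -> tm a)
    (t : tm a) : ty a :=
  ty_id A (f t) t.

Lemma wf_ty_fixed (T : mode_theory) (a : mode T) (A : ty a) f G t :
  rigid A -> natural A A f -> wf_ctx G -> wf_tm G t A ->
  wf_ty G Large (ty_fixed A f t).
Proof. intros hA [fw _ _] hG ht; apply wf_ty_id; auto with mtt. Qed.

Lemma eq_ty_fixed (T : mode_theory) (a : mode T) (A : ty a) f G t t' :
  rigid A -> natural A A f -> wf_ctx G -> wf_tm G t A -> eq_tm G t t' A ->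
  eq_ty G Large (ty_fixed A f t) (ty_fixed A f t').
Proof. intros hA [_ fe _] hG ht he; apply eq_ty_id; auto with mtt. Qed.

Lemma eq_ty_fixed_sub (T : mode_theory) (a : mode T) (A : ty a) f G H d t t' :
  rigid A -> natural A A f -> wf_sub G d H -> wf_ctx G -> wf_ctx H ->
  wf_tm H t A -> eq_tm G (tm_sub t d) t' A ->
  eq_ty G Large (ty_sub (ty_fixed A f t) d) (ty_fixed A f t').
Proof.
  intros hA [fw fe fs] hd hG hH ht he.
  assert (htd : wf_tm G (tm_sub t d) A) by (eapply wf_tm_rsub; eauto).
  eapply eq_ty_trans; [eapply eq_ty_sub_idt; eauto with mtt|].
  apply eq_ty_id.
  - eapply rigid_sub; eauto.
  - eapply eq_tm_rty_sub; eauto.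
    eapply eq_tm_trans; [eapply fs; eauto|auto].
  - eapply eq_tm_rty_sub; eauto.
Qed.

Lemma wf_refl_fixed (T : mode_theory) (a : mode T) (A : ty a) f G t :
  rigid A -> wf_ctx G -> wf_tm G t A -> eq_tm G (f t) t A ->
  wf_tm G (tm_refl t) (ty_fixed A f t).
Proof.
  intros; eapply wf_tm_ty; [auto| |apply wf_tm_refl; eauto].
  apply eq_ty_id; auto using eq_tm_sym with mtt.
Qed.

Lemma wf_tm_lam_natural (T : mode_theory) (a : mode T) (A B : ty a) f G :
  rigid A -> rigid B -> natural A B f -> wf_ctx G ->
  wf_tm G (tm_lam (hid a) (f (tm_var a))) (ty_arrow A B).
Proof.
  intros hA hB [fw _ _] hG.
  apply wf_tm_lam; auto with mtt.
  eapply wf_tm_rty_sub; eauto with mtt.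
Qed.

(** The form fits [ty_section], where weakened abstractions are applied, the outer one to an
    argument that is itself an application still to be computed. *)
Lemma eq_tm_app_natural (T : mode_theory) (a : mode T) (A B : ty a) f G H d t t' :
  rigid A -> rigid B -> natural A B f -> wf_sub G d H -> wf_ctx G -> wf_ctx H ->
  wf_tm G t A -> eq_tm G t' t A ->
  eq_tm G (tm_app (hid a) (tm_sub (tm_lam (hid a) (f (tm_var a))) d) t') (f t) B.
Proof.
  intros hA hB nf hd hG hH ht he.
  destruct nf as [fw fe fs].
  assert (hl : wf_sub (cx_ext (hid a) G A) (sb_lift (hid a) d) (cx_ext (hid a) H A))
    by auto with mtt.
  assert (hi : wf_sub G (sb_inst (hid a) t) (cx_ext (hid a) G A)) by auto with mtt.
  (* By naturality the lifted substitution reaches the bound variable and returns it, so the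
     abstraction is invariant under [d]. *)
  assert (hfl : eq_tm (cx_ext (hid a) G A)
    (tm_sub (f (tm_var a)) (sb_lift (hid a) d)) (f (tm_var a)) B).
  { eapply eq_tm_trans; [eapply fs; eauto with mtt|].
    apply fe; auto with mtt; [eapply wf_tm_rsub; eauto with mtt|].
    eapply eq_tm_rvar_ext_id; eauto with mtt. }
  assert (hlam : eq_tm G (tm_sub (tm_lam (hid a) (f (tm_var a))) d)
    (tm_lam (hid a) (f (tm_var a))) (ty_pi (hid a) A B)).
  { assert (hA' : wf_ctx (cx_lock (hid a) H)) by auto with mtt.
    assert (hp : eq_ty G Large (ty_sub (ty_pi (hid a) A B) d) (ty_pi (hid a) A B)).
    { eapply eq_ty_trans; [eapply eq_ty_sub_pi; eauto with mtt|].
      assert (hAd : eq_ty (cx_lock (hid a) G) Large (ty_sub A (sb_lock (hid a) d)) A)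
        by (eapply rigid_sub; eauto with mtt).
      apply eq_ty_sym, eq_ty_pi; [apply eq_ty_sym, hAd|].
      apply eq_ty_sym; eapply rigid_sub; eauto with mtt. }
    eapply eq_tm_trans.
    - eapply eq_tm_ty; [auto|exact hp|eapply eq_tm_sub_lam; eauto with mtt].
    - apply eq_tm_lam; auto with mtt. }
  assert (hBi : eq_ty G Large (ty_sub B (sb_inst (hid a) t)) B)
    by (eapply rigid_sub; eauto with mtt).
  eapply eq_tm_trans.
  - apply eq_tm_sym; eapply eq_tm_ty; [auto|exact hBi|].
    apply eq_tm_app with (A := A); [apply eq_tm_sym, hlam|].
    apply eq_tm_rlock_id; auto; apply eq_tm_sym, he.
  - eapply eq_tm_trans.
    + eapply eq_tm_ty; [auto|exact hBi|].
      apply eq_tm_lam_beta with (A := A); eauto with mtt.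
    + eapply eq_tm_trans; [eapply fs; eauto with mtt|].
      apply fe; auto; [eapply wf_tm_rsub; eauto with mtt|].
      eapply eq_tm_rvar_ext_id; eauto with mtt.
Qed.

Lemma wf_tm_section (T : mode_theory) (a : mode T) (A B : ty a) f g G M :
  rigid A -> rigid B -> natural A B f -> natural B A g -> wf_ctx G ->
  wf_tm (cx_ext (hid a) G A) M (ty_fixed A (fun t => g (f t)) (tm_var a)) ->
  wf_tm G (tm_lam (hid a) M)
    (ty_section A (tm_lam (hid a) (f (tm_var a))) (tm_lam (hid a) (g (tm_var a)))).
Proof.
  intros hA hB nf ng hG hM.
  assert (nfg := natural_comp hB nf ng).
  assert (hw : wf_sub (cx_ext (hid a) G A) (sb_wk a) G) by auto with mtt.
  apply wf_tm_lam; auto with mtt.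
  eapply wf_tm_ty; [auto with mtt| |exact hM].
  apply eq_ty_id; auto with mtt.
  - apply eq_ty_sym; eapply rigid_sub; eauto with mtt.
  - apply eq_tm_sym.
    assert (fw := natural_wf nf).
    (* The outer application is computed first; the equation required of its argument is the
       computation of the inner one. *)
    eapply (eq_tm_app_natural hB hA ng hw); eauto with mtt.
    eapply (eq_tm_app_natural hA hB nf hw); eauto with mtt.
Qed.

Lemma eq_tm_mod_sub (T : mode_theory) (a b : mode T) (u : hom a b) (A : ty a) G H d t t' :
  rigid A -> wf_sub G d H -> wf_ctx G -> wf_ctx H -> wf_tm (cx_lock u H) t A ->
  eq_tm (cx_lock u G) (tm_sub t (sb_lock u d)) t' A ->
  eq_tm G (tm_sub (tm_mod u t) d) (tm_mod u t') (ty_mod u A).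
Proof.
  intros hA hd hG hH ht he.
  eapply eq_tm_trans.
  - eapply eq_tm_ty; [auto| |eapply eq_tm_sub_mod; eauto].
    eapply rigid_sub; eauto with mtt.
  - apply eq_tm_mod; auto.
Qed.

(** * Elimination along the counit *)

(** The identity types to be inhabited depend on a boolean and are not treated as rigid, so modal
    elimination into a constant motive is set up again for arbitrary [A] and [B], with the weakening
    of [B] explicit. *)
Lemma wf_tm_let_const (T : mode_theory) (a b c : mode T) (v : hom b c) (u : hom a b)
    (A : ty a) (B : ty c) G M0 M1 :
  wf_ctx G -> wf_ty (cx_lock u (cx_lock v G)) Large A -> wf_ty G Large B ->
  wf_tm (cx_lock v G) M0 (ty_mod u A) ->
  wf_tm (cx_ext (hcomp v u) G A) M1 (ty_sub B (sb_wk c)) ->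
  wf_tm G (tm_let v u (ty_sub B (sb_wk c)) M0 M1) B.
Proof.
  intros hG hA hB h0 h1.
  assert (hvG : wf_ctx (cx_lock v G)) by auto with mtt.
  assert (hA' : wf_ty (cx_lock (hcomp v u) G) Large A).
  { eapply wf_ty_conv; [apply eq_cx_lock_comp; auto|auto]. }
  assert (hGA : wf_ctx (cx_ext (hcomp v u) G A)) by (apply wf_cx_ext; auto).
  assert (hm : wf_ty (cx_lock v G) Large (ty_mod u A)) by (apply wf_ty_mod; auto).
  assert (hw1 : wf_sub (cx_ext (hcomp v u) G A) (sb_wk c) G) by auto with mtt.
  assert (hw2 : wf_sub (cx_ext v G (ty_mod u A)) (sb_wk c) G) by auto with mtt.
  assert (hmv : wf_tm (cx_lock v (cx_ext (hcomp v u) G A)) (tm_mod u (tm_var a))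
    (ty_sub (ty_mod u A) (sb_lock v (sb_wk c)))).
  { eapply wf_tm_ty; [auto with mtt|apply eq_ty_sym; eapply eq_ty_sub_mod;
      [apply wf_sb_lock, hw1|auto]|].
    apply wf_tm_mod; [auto with mtt|].
    eapply wf_tm_conv; [apply eq_cx_sym, eq_cx_lock_comp, hGA| |
      apply wf_tm_var; auto].
    eapply eq_ty_sub; [|apply eq_ty_refl, hA'].
    eapply eq_sb_conv; [apply eq_cx_refl|apply eq_cx_refl|apply eq_sb_sym,
      eq_sb_lock_hcomp, hw1]; auto with mtt. }
  assert (hext : wf_sub (cx_ext (hcomp v u) G A)
    (sb_ext v (sb_wk c) (tm_mod u (tm_var a))) (cx_ext v G (ty_mod u A)))
    by (apply wf_sb_ext; auto).
  assert (h0' : wf_tm (cx_lock v G) M0 (ty_sub (ty_mod u A) (sb_lock v (sb_id c)))).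
  { eapply wf_tm_ty; [auto| |exact h0].
    apply eq_ty_sym; eapply eq_ty_trans; [|apply eq_ty_sub_id, hm].
    eapply eq_ty_sub; [apply eq_sb_lock_sb_id, hG|apply eq_ty_refl, hm]. }
  assert (hi : wf_sub G (sb_inst v M0) (cx_ext v G (ty_mod u A)))
    by (apply wf_sb_ext; auto with mtt).
  eapply wf_tm_ty; [auto| |eapply wf_tm_let; eauto].
  - eapply eq_ty_trans; [eapply eq_ty_sub_comp; eauto|].
    eapply eq_ty_trans; [|apply eq_ty_sub_id, hB].
    eapply eq_ty_sub; [|apply eq_ty_refl, hB].
    eapply eq_sb_wk_ext; eauto with mtt.
  - eapply wf_ty_sub; eauto.
  - eapply wf_tm_ty; [auto| |exact h1].
    apply eq_ty_sym; eapply eq_ty_trans; [eapply eq_ty_sub_comp; eauto|].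
    eapply eq_ty_sub; [|apply eq_ty_refl, hB].
    eapply eq_sb_wk_ext; eauto with mtt.
Qed.

(** Unpacking along [eps] yields a term of [A] substituted by the key of [eps]. The equation of that
    type with [B] is a hypothesis, to be supplied by the triangle identity. *)
Lemma wf_tm_let_counit (G : ctx n) (A B : ty n) M :
  wf_ctx G -> wf_ty (cx_lock mu (cx_lock nu G)) Large A -> wf_ty G Large B ->
  eq_ty G Large (ty_sub A (sb_key eps G)) B ->
  wf_tm (cx_lock nu G) M (ty_mod mu A) ->
  wf_tm G (tm_let nu mu (ty_sub B (sb_wk n)) M
    (tm_sub (tm_var n) (sb_key eps (cx_ext (hcomp nu mu) G A)))) B.
Proof.
  intros hG hA hB hAB hM.
  apply wf_tm_let_const with (A := A); auto.
  assert (hA' : wf_ty (cx_lock (hcomp nu mu) G) Large A).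
  { eapply wf_ty_conv; [apply eq_cx_lock_comp; auto|auto]. }
  assert (hGA : wf_ctx (cx_ext (hcomp nu mu) G A)) by (apply wf_cx_ext; auto).
  assert (hw : wf_sub (cx_ext (hcomp nu mu) G A) (sb_wk n) G) by auto with mtt.
  assert (hk := wf_sub_key_to_id eps hG).
  assert (hk' := wf_sub_key_to_id eps hGA).
  assert (hl := wf_sb_lock (hcomp nu mu) hw).
  eapply wf_tm_ty; [auto| |eapply wf_tm_sub; [exact hk'|apply wf_tm_var; auto]].
  eapply eq_ty_trans; [eapply eq_ty_sub_comp; eauto|].
  (* Naturality at the weakening trades the key over the extended context for the key over [G]. *)
  eapply eq_ty_trans; [eapply eq_ty_sub;
    [apply eq_sb_sym, eq_sub_key_to_id_nat; eauto|apply eq_ty_refl, hA']|].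
  eapply eq_ty_trans; [apply eq_ty_sym; eapply eq_ty_sub_comp; eauto|].
  eapply eq_ty_sub; [apply eq_sb_refl, hw|exact hAB].
Qed.

(** * The two round trips and their values on literals *)

Definition nu_trip (t : tm n) : tm n := mod_if nu (from_nu t).

Lemma natural_nu_trip : natural bool_nu bool_nu nu_trip.
Proof.
  exact (natural_comp (rigid_bool n) natural_from_nu (natural_mod_if nu)).
Qed.

Lemma natural_bool_trip :
  natural (ty_bool n) (ty_bool n) (fun t => from_nu (mod_if nu t)).
Proof.
  exact (natural_comp rigid_bool_nu (natural_mod_if nu) natural_from_nu).
Qed.
#[local] Hint Resolve natural_nu_trip natural_bool_trip : mtt.

Lemma eq_from_nu_lit (G : ctx n) (c : bool) :
  wf_ctx G -> eq_tm G (from_nu (tm_mod nu (tm_lit m c))) (tm_lit n c) (ty_bool n).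
Proof.
  intros; eapply eq_tm_trans;
    [apply eq_from_nu_mod|apply eq_nu_elim_bool_lit]; auto with mtt.
Qed.

Lemma eq_nu_trip_lit (G : ctx n) (c : bool) :
  wf_ctx G ->
  eq_tm G (nu_trip (tm_mod nu (tm_lit m c))) (tm_mod nu (tm_lit m c)) bool_nu.
Proof.
  intros; eapply eq_tm_trans; [|apply eq_mod_if_lit; auto].
  apply eq_mod_if; auto using eq_from_nu_lit, wf_from_nu with mtt.
Qed.

Lemma eq_bool_trip_lit (G : ctx n) (c : bool) :
  wf_ctx G -> eq_tm G (from_nu (mod_if nu (tm_lit n c))) (tm_lit n c) (ty_bool n).
Proof.
  intros; eapply eq_tm_trans; [|apply eq_from_nu_lit; auto].
  apply eq_from_nu; auto using eq_mod_if_lit with mtt.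
Qed.

(** * Boolean induction below the lock [nu] *)

Definition nu_fixed (t : tm n) : ty n := ty_fixed bool_nu nu_trip t.

(** [<mu | nu_fixed (mod_nu t)>]: [eta] brings [t] under the two locks, which lets the
    boolean eliminator vary [t] under the identity modality. *)
Definition mu_fixed (D : ctx m) (t : tm m) : ty m :=
  ty_mod mu (nu_fixed (tm_mod nu (tm_sub t (sb_key eta D)))).

Lemma wf_mod_eta (D : ctx m) t :
  wf_ctx D -> wf_tm D t (ty_bool m) ->
  wf_tm (cx_lock mu D) (tm_mod nu (tm_sub t (sb_key eta D))) bool_nu.
Proof.
  intros; apply wf_tm_mod; auto with mtt.
  eapply wf_tm_rsub; [|apply wf_sub_eta|..]; auto with mtt.
Qed.
#[local] Hint Resolve wf_mod_eta : mtt.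

Lemma wf_mu_fixed (D : ctx m) t :
  wf_ctx D -> wf_tm D t (ty_bool m) -> wf_ty D Large (mu_fixed D t).
Proof. intros; apply wf_ty_mod; auto; apply wf_ty_fixed; auto with mtt. Qed.

(** The key inside [mu_fixed] records its context; naturality of [eta] moves [d] past it and
    replaces [E] by [D]. *)
Lemma eq_mu_fixed_sub (D E : ctx m) d t t' :
  wf_sub D d E -> wf_ctx D -> wf_ctx E -> wf_tm E t (ty_bool m) ->
  eq_tm D (tm_sub t d) t' (ty_bool m) ->
  eq_ty D Large (ty_sub (mu_fixed E t) d) (mu_fixed D t').
Proof.
  intros hd hD hE ht he.
  assert (hmd := wf_sb_lock mu hd).
  assert (hnmd := wf_sb_lock nu hmd).
  assert (heD := wf_sub_eta hD).
  assert (heE := wf_sub_eta hE).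
  eapply eq_ty_trans; [eapply eq_ty_sub_mod; [exact hd|]|].
  { apply wf_ty_fixed; auto with mtt. }
  apply eq_ty_mod; auto.
  eapply eq_ty_fixed_sub; eauto with mtt.
  eapply eq_tm_mod_sub; eauto with mtt.
  { eapply wf_tm_rsub; eauto with mtt. }
  eapply eq_tm_trans; [eapply eq_tm_rsub_comp; [|exact hnmd|exact heE|..]; auto with mtt|].
  eapply eq_tm_trans.
  { eapply eq_tm_rsub; [|exact (wf_sb_comp hnmd heE)| | |apply eq_sub_eta_nat|];
      eauto with mtt. }
  eapply eq_tm_trans;
    [apply eq_tm_sym; eapply eq_tm_rsub_comp; [|exact heD|exact hd|..]; auto with mtt|].
  eapply eq_tm_rsub; [|exact heD|..]; auto with mtt.
Qed.

(** Reflexivity suffices because [nu_trip] computes on literals, and the key of [eta] fixes the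
    literal. *)
Lemma wf_mu_fixed_lit (D : ctx m) (c : bool) :
  wf_ctx D ->
  wf_tm D (tm_mod mu (tm_refl (tm_mod nu (tm_lit m c)))) (mu_fixed D (tm_lit m c)).
Proof.
  intros hD.
  assert (heD := wf_sub_eta hD).
  apply wf_tm_mod; auto.
  eapply wf_tm_ty; [auto with mtt| |apply wf_refl_fixed with (A := bool_nu);
    [auto with mtt..|apply eq_nu_trip_lit; auto with mtt]].
  apply eq_ty_fixed; auto with mtt.
  apply eq_tm_mod; auto with mtt.
  apply eq_tm_sym; eapply eq_tm_lit_sub; exact heD.
Qed.

(** The motive is formed over the context extended by the boolean, which its key must record;
    instantiation brings it back to [D] by [eq_mu_fixed_sub]. *)
Definition mu_fixed_elim (D : ctx m) (t : tm m) : tm m :=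
  tm_if (mu_fixed (cx_ext (hid m) D (ty_bool m)) (tm_var m))
    (tm_mod mu (tm_refl (tm_mod nu (tm_lit m true))))
    (tm_mod mu (tm_refl (tm_mod nu (tm_lit m false)))) t.

Lemma wf_mu_fixed_elim (D : ctx m) t :
  wf_ctx D -> wf_tm D t (ty_bool m) -> wf_tm D (mu_fixed_elim D t) (mu_fixed D t).
Proof.
  intros hD ht.
  assert (hi : forall s, wf_tm D s (ty_bool m) -> eq_ty D Large
    (ty_sub (mu_fixed (cx_ext (hid m) D (ty_bool m)) (tm_var m)) (sb_inst (hid m) s))
    (mu_fixed D s)).
  { intros s hs; eapply eq_mu_fixed_sub; [apply wf_sub_rinst|..]; auto with mtt.
    eapply eq_tm_rvar_ext_id; auto with mtt. }
  eapply wf_tm_ty; [auto|apply hi, ht|].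
  apply wf_tm_if; auto.
  - apply wf_mu_fixed; auto with mtt.
  - eapply wf_tm_ty; [auto|apply eq_ty_sym, hi|apply wf_mu_fixed_lit]; auto with mtt.
  - eapply wf_tm_ty; [auto|apply eq_ty_sym, hi|apply wf_mu_fixed_lit]; auto with mtt.
Qed.

(** The [eta] of [mu_fixed] meets the [eps] of the counit, and the triangle identity
    returns [t]. *)
Lemma eq_nu_fixed_triangle (G : ctx n) t :
  wf_ctx G -> wf_tm (cx_lock nu G) t (ty_bool m) ->
  eq_ty G Large
    (ty_sub (nu_fixed (tm_mod nu (tm_sub t (sb_key eta (cx_lock nu G))))) (sb_key eps G))
    (nu_fixed (tm_mod nu t)).
Proof.
  intros hG ht.
  assert (hnG : wf_ctx (cx_lock nu G)) by auto with mtt.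
  assert (heG := wf_sub_eta hnG).
  assert (hk := wf_sub_eps hG).
  assert (hnk := wf_sb_lock nu hk).
  eapply eq_ty_fixed_sub; [| |exact hk|..]; auto with mtt.
  eapply eq_tm_mod_sub; [|exact hk|..]; auto with mtt.
  { eapply wf_tm_rsub; eauto with mtt. }
  eapply eq_tm_trans; [eapply eq_tm_rsub_comp; [|exact hnk|exact heG|..]; auto with mtt|].
  eapply eq_tm_trans; [|apply eq_tm_sub_id, ht].
  eapply eq_tm_rsub; [|exact (wf_sb_comp hnk heG)| | |apply eq_sub_triangle|];
    auto with mtt.
Qed.

(** [G] is an argument because the keys record raw contexts. The local [A] still contains the key of
    [eta], while the motive states the goal after the triangle has cancelled it. *)
Definition nu_fixed_elim (G : ctx n) (t : tm m) : tm n :=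
  let A := nu_fixed (tm_mod nu (tm_sub t (sb_key eta (cx_lock nu G)))) in
  tm_let nu mu (ty_sub (nu_fixed (tm_mod nu t)) (sb_wk n))
    (mu_fixed_elim (cx_lock nu G) t)
    (tm_sub (tm_var n) (sb_key eps (cx_ext (hcomp nu mu) G A))).

Lemma wf_nu_fixed_elim (G : ctx n) t :
  wf_ctx G -> wf_tm (cx_lock nu G) t (ty_bool m) ->
  wf_tm G (nu_fixed_elim G t) (nu_fixed (tm_mod nu t)).
Proof.
  intros hG ht.
  apply wf_tm_let_counit; auto.
  - apply wf_ty_fixed; auto with mtt.
  - apply wf_ty_fixed; auto with mtt; apply wf_tm_mod; auto.
  - apply eq_nu_fixed_triangle; auto.
  - apply wf_mu_fixed_elim; auto with mtt.
Qed.

(** * The two homotopies and the equivalence *)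

Lemma nu_fixed_var (G : ctx n) :
  wf_ctx G -> exists M,
  wf_tm (cx_ext (hid n) G bool_nu) M (nu_fixed (tm_var n)).
Proof.
  intros hG.
  pose (G1 := cx_ext (hid n) G bool_nu).
  assert (hG1 : wf_ctx G1) by (unfold G1; auto with mtt).
  assert (hv : wf_tm G1 (tm_var n) bool_nu) by (unfold G1; auto with mtt).
  (* Modal elimination of the variable, with dependent motive, reduces the claim to [mod_nu(x)] for
     a fresh boolean [x] below [nu], where [nu_fixed_elim] applies. *)
  exists (tm_let (hid n) nu (nu_fixed (tm_var n)) (tm_var n)
    (nu_fixed_elim (cx_ext nu G1 (ty_bool m)) (tm_var m))).
  assert (hi : wf_sub G1 (sb_inst (hid n) (tm_var n)) (cx_ext (hid n) G1 bool_nu))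
    by auto with mtt.
  assert (he := wf_sub_rmod_ext (hid n) nu (rigid_bool m) hG1).
  eapply wf_tm_ty; [auto| |eapply wf_tm_let with (A := ty_bool m)].
  - eapply eq_ty_fixed_sub; [| |exact hi|..]; auto with mtt.
    eapply eq_tm_rvar_ext_id; auto with mtt.
  - apply wf_ty_fixed; auto with mtt.
  - auto with mtt.
  - eapply wf_tm_ty; [auto with mtt| |apply wf_nu_fixed_elim; auto with mtt].
    apply eq_ty_sym; eapply eq_ty_fixed_sub; [| |exact he|..]; auto with mtt.
    eapply eq_tm_rvar_ext_id; auto with mtt.
    apply wf_tm_mod; auto with mtt.
Qed.

Lemma bool_fixed_var (G : ctx n) :
  wf_ctx G -> exists M, wf_tm (cx_ext (hid n) G (ty_bool n)) M
    (ty_fixed (ty_bool n) (fun t => from_nu (mod_if nu t)) (tm_var n)).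
Proof.
  intros hG.
  pose (G1 := cx_ext (hid n) G (ty_bool n)).
  assert (hG1 : wf_ctx G1) by (unfold G1; auto with mtt).
  assert (hv : wf_tm G1 (tm_var n) (ty_bool n)) by (unfold G1; auto with mtt).
  pose (S := ty_fixed (ty_bool n) (fun t => from_nu (mod_if nu t))).
  (* By cases on the variable; reflexivity serves in both branches because this round trip computes
     on literals. *)
  exists (tm_if (S (tm_var n)) (tm_refl (tm_lit n true)) (tm_refl (tm_lit n false))
    (tm_var n)).
  assert (hi : forall s, wf_tm G1 s (ty_bool n) ->
    eq_ty G1 Large (ty_sub (S (tm_var n)) (sb_inst (hid n) s)) (S s)).
  { intros s hs; eapply eq_ty_fixed_sub; [| |apply (wf_sub_rinst (A := ty_bool n))|..];
      auto with mtt.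
    eapply eq_tm_rvar_ext_id; auto with mtt. }
  eapply wf_tm_ty; [auto|apply hi, hv|].
  apply wf_tm_if; auto.
  - apply wf_ty_fixed; auto with mtt.
  - eapply wf_tm_ty; [auto|apply eq_ty_sym, hi; auto with mtt|].
    apply wf_refl_fixed; auto with mtt; exact (eq_bool_trip_lit true hG1).
  - eapply wf_tm_ty; [auto|apply eq_ty_sym, hi; auto with mtt|].
    apply wf_refl_fixed; auto with mtt; exact (eq_bool_trip_lit false hG1).
Qed.

Theorem theorem10p4 (G : ctx n) (hG : wf_ctx G) :
  ty_equiv G (ty_mod nu (ty_bool m)) (ty_bool n).
Proof.
  assert (rX := rigid_bool_nu); assert (rB := rigid_bool n).
  assert (nf := natural_from_nu); assert (ng := natural_mod_if nu).
  destruct (nu_fixed_var hG) as [h hh], (bool_fixed_var hG) as [k hk].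
  split; [|split].
  - apply (rigid_wf rX hG).
  - apply (rigid_wf rB hG).
  - exists (tm_lam (hid n) (from_nu (tm_var n))),
      (tm_lam (hid n) (mod_if nu (tm_var n))), (tm_lam (hid n) h), (tm_lam (hid n) k).
    repeat split.
    + apply (wf_tm_lam_natural rX rB nf hG).
    + apply (wf_tm_lam_natural rB rX ng hG).
    (* [nu_trip] unfolds to [mod_if nu] after [from_nu], so [hh] has the required type by
       conversion. *)
    + apply (wf_tm_section rX rB nf ng hG hh).
    + apply (wf_tm_section rB rX ng nf hG hk).
Qed.
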